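(* Let $G$ be a Lie group with a two-dimensional commutator subgroup, equipped with a left-invariant Randers metric $F$ defined by a left-invariant Riemannian metric $g$ and a left-invariant vector field $X\neq 0$ with $\|X\|_g<1$, where $\|\cdot\|_g=\sqrt{g(\cdot,\cdot)}$. Then: 1. $F$ is of Douglas type if and only if $X\in\mathcal P$. 2. $F$ is of Berwald type if and only if $X\in\ker(f_1)\cap\ker(f_2)\cap\operatorname{span}\{a_1,b_2,a_2+b_1\}^{\perp}$.
   Context: $G$ is a connected $n$-dimensional real Lie group with Lie algebra $\mathfrak g$ (left-invariant vector fields) such that $\mathfrak g'=[\mathfrak g,\mathfrak g]$ has dimension $2$ (equivalently, the commutator subgroup is two-dimensional). $g$ is a left-invariant Riemannian metric on $G$, with induced inner product $\langle\cdot,\cdot\rangle$ on $\mathfrak g$. $\{e_1,e_2\}$ is an orthonormal basis of $\mathfrak g'$ and $\mathcal P$ is the $(n-2)$-dimensional orthogonal complement of $\mathfrak g'$ in $\mathfrak g$. The vectors $a_1,a_2,b_1,b_2\in\mathcal P$ and skew-symmetric linear maps $f_1,f_2:\mathcal P\to\mathcal P$ are uniquely determined by: for all $u,v\in\mathcal P$, $[u,e_1]=\langle a_1,u\rangle e_1+\langle a_2,u\rangle e_2$, $[u,e_2]=\langle b_1,u\rangle e_1+\langle b_2,u\rangle e_2$, $[u,v]=\langle f_1(u),v\rangle e_1+\langle f_2(u),v\rangle e_2$. Since $f_1,f_2$ are defined on $\mathcal P$, their kernels are subspaces of $\mathcal P$; $\perp$ is the $g$-orthogonal complement. The Randers metric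 defined by $g$ and $X$ is $F_x(y)=\sqrt{g_x(y,y)}+g_x(X_x,y)$, $y\in T_xG$. It is of Berwald type if the Christoffel symbols of its Chern connection in standard local coordinates $(x,y)$ depend only on $x$; for Randers metrics this is equivalent to $X$ being parallel with respect to the Levi-Civita connection of $g$. It is of Douglas type if the $1$-form $\beta=g(X,\cdot)$ is closed, equivalently $g(X,[Y,Z])=0$ for all $Y,Z\in\mathfrak g$. *)

(* Defs.v *)
From HB Require Import structures.
From mathcomp Require Import all_boot all_order all_algebra.
From mathcomp Require Import all_classical all_reals all_analysis.

Set Implicit Arguments.
Unset Strict Implicit.
Unset Printing Implicit Defensive.

Import Order.TTheory GRing.Theory Num.Theory.
Import numFieldNormedType.Exports.

Local Open Scope classical_set_scope.
Local Open Scope ring_scope.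

(* For open [U] and finite-dimensional [V]: continuity of all directional
   derivatives up to order [k]; the value of ['D_v f] at a point of [U] only
   depends on [f] near that point. *)
Fixpoint Ck_on (R : realType) (V W : normedModType R) (k : nat)
    (U : set V) (f : V -> W) : Prop :=
  match k with
  | 0 => forall x, U x -> {for x, continuous f}
  | k'.+1 => (forall x, U x -> differentiable f x) /\
             (forall v, Ck_on k' U (fun x => 'D_v f x))
  end.

Definition smooth_on (R : realType) (V W : normedModType R)
    (U : set V) (f : V -> W) : Prop := forall k, Ck_on k U f.

Definition basis_vec (R : realType) (n : nat) (i : 'I_n) : 'rV[R]_n :=
  delta_mx 0 i.

(* Charts are total functions, meaningful on [chart_dom i] and on its image
   [chart_img]. The arbitrary choice [chart_at] of a chart around every point
   serves to realize each tangent space as ['rV[R]_n] (see below). *)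
Record smooth_atlas (R : realType) (n : nat) (M : topologicalType) := SmoothAtlas {
  chart : Type;
  chart_dom : chart -> set M;
  chart_map : chart -> M -> 'rV[R]_n;
  chart_inv : chart -> 'rV[R]_n -> M;
  chart_at : M -> chart;
  chart_at_dom : forall p, chart_dom (chart_at p) p;
  chart_dom_open : forall i, open (chart_dom i);
  chart_img_open : forall i, open (chart_map i @` chart_dom i);
  chart_mapK : forall i p, chart_dom i p -> chart_inv i (chart_map i p) = p;
  chart_map_continuous : forall i p, chart_dom i p ->
    {for p, continuous (chart_map i)};
  chart_inv_continuous : forall i p, chart_dom i p ->
    {for chart_map i p, continuous (chart_inv i)};
  transition_smooth : forall i j,
    smooth_on (chart_map i @` (chart_dom i `&` chart_dom j))
              (chart_map j \o chart_inv i) }.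

Definition chart_img (R : realType) (n : nat) (M : topologicalType)
    (A : smooth_atlas R n M) (i : chart A) : set 'rV[R]_n :=
  chart_map i @` chart_dom i.

HB.structure Definition TopGroup := {G of Group G & Topological G}.

Definition lie_group (R : realType) (n : nat) (G : TopGroup.type)
    (A : smooth_atlas R n G) : Prop :=
  [/\ hausdorff_space G,
      @second_countable G,
      continuous (fun p : G * G => (p.1 * p.2)%g) /\
        (forall i j k : chart A, smooth_on
          [set z : 'rV[R]_n * 'rV[R]_n |
            [/\ chart_img i z.1, chart_img j z.2 &
                chart_dom k (chart_inv i z.1 * chart_inv j z.2)%g]]
          (fun z : 'rV[R]_n * 'rV[R]_n =>
            chart_map k (chart_inv i z.1 * chart_inv j z.2)%g)) &
      continuous (fun p : G => p^-1%g) /\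
        (forall i k : chart A, smooth_on
          [set z | chart_img i z /\ chart_dom k (chart_inv i z)^-1%g]
          (fun z => chart_map k (chart_inv i z)^-1%g))].

(* A tangent vector at [p] is given by its coordinates in the chart
   [chart_at A p]; a vector field is any function assigning to every point a
   tangent vector at that point. *)
Definition vfield (R : realType) (n : nat) (M : topologicalType)
    (A : smooth_atlas R n M) : Type := M -> 'rV[R]_n.

(* Coordinates in the chart [i] of the tangent vector [u] at [p]. *)
Definition tcoord (R : realType) (n : nat) (M : topologicalType)
    (A : smooth_atlas R n M) (i : chart A) (p : M) (u : 'rV[R]_n) : 'rV[R]_n :=
  'd (chart_map i \o chart_inv (chart_at A p)) (chart_map (chart_at A p) p) u.

(* The tangent vector at [p] with coordinates [y] in the chart [i]. *)
Definition tvec (R : realType) (n : nat) (M : topologicalType)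
    (A : smooth_atlas R n M) (i : chart A) (p : M) (y : 'rV[R]_n) : 'rV[R]_n :=
  'd (chart_map (chart_at A p) \o chart_inv i) (chart_map i p) y.

Definition tangent_map (R : realType) (n : nat) (M : topologicalType)
    (A : smooth_atlas R n M) (h : M -> M) (p : M) (u : 'rV[R]_n) : 'rV[R]_n :=
  'd (chart_map (chart_at A (h p)) \o h \o chart_inv (chart_at A p))
     (chart_map (chart_at A p) p) u.

Definition vf_coord (R : realType) (n : nat) (M : topologicalType)
    (A : smooth_atlas R n M) (i : chart A) (Y : vfield A) (z : 'rV[R]_n)
    : 'rV[R]_n :=
  tcoord i (chart_inv i z) (Y (chart_inv i z)).

Definition smooth_vf (R : realType) (n : nat) (M : topologicalType)
    (A : smooth_atlas R n M) (Y : vfield A) : Prop :=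
  forall i : chart A, smooth_on (chart_img i) (vf_coord i Y).

(* [Y, Z]^j = Y^i d_i Z^j - Z^i d_i Y^j at [p], in the chart [chart_at A p]. *)
Definition bracket (R : realType) (n : nat) (M : topologicalType)
    (A : smooth_atlas R n M) (Y Z : vfield A) : vfield A :=
  fun p => let i := chart_at A p in
    'D_(Y p) (vf_coord i Z) (chart_map i p) -
    'D_(Z p) (vf_coord i Y) (chart_map i p).

Definition left_invariant (R : realType) (n : nat) (G : TopGroup.type)
    (A : smooth_atlas R n G) (Y : vfield A) : Prop :=
  forall a p : G, tangent_map A (fun q => a * q)%g p (Y p) = Y (a * p)%g.

Definition lie_algebra (R : realType) (n : nat) (G : TopGroup.type)
    (A : smooth_atlas R n G) : set (vfield A) :=
  [set Y | smooth_vf Y /\ left_invariant Y].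

Definition lin_span (R : realType) (V : lmodType R) (S : set V) : set V :=
  [set w | exists (m : nat) (c : 'I_m -> R) (s : 'I_m -> V),
     (forall k, S (s k)) /\ w = \sum_(k < m) c k *: s k].

Definition derived_algebra (R : realType) (n : nat) (G : TopGroup.type)
    (A : smooth_atlas R n G) : set (vfield A) :=
  lin_span [set W | exists Y Z : vfield A,
    [/\ lie_algebra Y, lie_algebra Z & W = bracket Y Z]].

Arguments derived_algebra {R n G} A.

(* A field of bilinear forms, as Gram matrices in the chart [chart_at]. *)
Definition tensor2 (R : realType) (n : nat) (M : topologicalType)
    (A : smooth_atlas R n M) : Type := M -> 'M[R]_n.

Definition metric_at (R : realType) (n : nat) (M : topologicalType)
    (A : smooth_atlas R n M) (g : tensor2 A) (p : M) (u v : 'rV[R]_n) : R :=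
  (u *m g p *m v^T) 0 0.

Definition riemannian_metric (R : realType) (n : nat) (M : topologicalType)
    (A : smooth_atlas R n M) (g : tensor2 A) : Prop :=
  [/\ forall p u v, metric_at g p u v = metric_at g p v u,
      forall p u, u != 0 -> 0 < metric_at g p u u &
      forall (i : chart A) (a b : 'I_n), smooth_on (chart_img i)
        (fun z => metric_at g (chart_inv i z)
          (tvec i (chart_inv i z) (basis_vec R a))
          (tvec i (chart_inv i z) (basis_vec R b)) : R)].

Definition left_invariant_metric (R : realType) (n : nat) (G : TopGroup.type)
    (A : smooth_atlas R n G) (g : tensor2 A) : Prop :=
  forall (a p : G) (u v : 'rV[R]_n),
    metric_at g (a * p)%g (tangent_map A (fun q => a * q)%g p u)
                          (tangent_map A (fun q => a * q)%g p v) =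
    metric_at g p u v.

(* The inner product induced on left-invariant fields by evaluation at 1. *)
Definition ip (R : realType) (n : nat) (G : TopGroup.type)
    (A : smooth_atlas R n G) (g : tensor2 A) (Y Z : vfield A) : R :=
  metric_at g 1%g (Y 1%g) (Z 1%g).

Definition orth_compl (R : realType) (n : nat) (G : TopGroup.type)
    (A : smooth_atlas R n G) (g : tensor2 A) (S : set (vfield A))
    : set (vfield A) :=
  [set Y | lie_algebra Y /\ forall W, S W -> ip g Y W = 0].

Definition linear_endo_on (R : realType) (V : lmodType R) (P : set V)
    (f : V -> V) : Prop :=
  (forall u, P u -> P (f u)) /\
  (forall (c : R) u v, P u -> P v -> f (c *: u + v) = c *: f u + f v).

Definition skew_on (R : realType) (n : nat) (G : TopGroup.type)
    (A : smooth_atlas R n G) (g : tensor2 A) (P : set (vfield A))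
    (f : vfield A -> vfield A) : Prop :=
  forall u v, P u -> P v -> ip g (f u) v = - ip g u (f v).

Definition ker_on (R : realType) (V : lmodType R) (P : set V)
    (f : V -> V) : set V := [set u | P u /\ f u = 0].

Definition randers (R : realType) (n : nat) (M : topologicalType)
    (A : smooth_atlas R n M) (g : tensor2 A) (X : vfield A)
    (p : M) (y : 'rV[R]_n) : R :=
  Num.sqrt (metric_at g p y y) + metric_at g p (X p) y.

(* The 1-form Z |-> g(X, Z). *)
Definition flat (R : realType) (n : nat) (M : topologicalType)
    (A : smooth_atlas R n M) (g : tensor2 A) (X : vfield A)
    (p : M) (u : 'rV[R]_n) : R :=
  metric_at g p (X p) u.

Definition closed_form (R : realType) (n : nat) (M : topologicalType)
    (A : smooth_atlas R n M) (beta : M -> 'rV[R]_n -> R) : Prop :=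
  forall (i : chart A) (z : 'rV[R]_n), chart_img i z -> forall a b : 'I_n,
    let comp (c : 'I_n) (w : 'rV[R]_n) : R :=
      beta (chart_inv i w) (tvec i (chart_inv i w) (basis_vec R c)) in
    'D_(basis_vec R a) (comp b) z = 'D_(basis_vec R b) (comp a) z.

(* A Randers metric is of Douglas type when its 1-form beta = g(X, -) is closed. *)
Definition randers_douglas (R : realType) (n : nat) (M : topologicalType)
    (A : smooth_atlas R n M) (g : tensor2 A) (X : vfield A) : Prop :=
  closed_form A (flat g X).

(* A Finsler function on [M] in standard local coordinates [(x, y)]. *)
Definition local_finsler (R : realType) (n : nat) (M : topologicalType)
    (A : smooth_atlas R n M) (F : M -> 'rV[R]_n -> R) (i : chart A)
    (x y : 'rV[R]_n) : R :=
  F (chart_inv i x) (tvec i (chart_inv i x) y).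

(* g_ab(x, y) = 1/2 d^2(L^2)/dy^a dy^b. *)
Definition fundamental_tensor (R : realType) (n : nat)
    (L : 'rV[R]_n -> 'rV[R]_n -> R) (x y : 'rV[R]_n) (a b : 'I_n) : R :=
  2^-1 * 'D_(basis_vec R a)
    (fun w => 'D_(basis_vec R b) (fun w' => L x w' ^+ 2) w) y.

(* [Gam x y m j k] are the coefficients Gamma^m_jk(x, y), with connection forms
   omega_j^m = Gamma^m_jk dx^k. The two clauses are Chern's structure equations
     dx^j /\ omega_j^m = 0,
     dg_ij - g_mj omega_i^m - g_im omega_j^m = 2 C_ijm (dy^m + y^l omega_l^m),
   with 2 C_ijm = dg_ij/dy^m, on the part y <> 0 of the tangent bundle; they
   have a unique solution. *)
Definition chern_connection (R : realType) (n : nat)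
    (L : 'rV[R]_n -> 'rV[R]_n -> R) (U : set 'rV[R]_n)
    (Gam : 'rV[R]_n -> 'rV[R]_n -> 'I_n -> 'I_n -> 'I_n -> R) : Prop :=
  forall x y : 'rV[R]_n, U x -> y != 0 ->
    (forall m j k : 'I_n, Gam x y m j k = Gam x y m k j) /\
    (forall i j k : 'I_n,
      'D_(basis_vec R k) (fun x' => fundamental_tensor L x' y i j) x
      - \sum_(m < n) fundamental_tensor L x y m j * Gam x y m i k
      - \sum_(m < n) fundamental_tensor L x y i m * Gam x y m j k
      = \sum_(m < n) 'D_(basis_vec R m)
                        (fun y' => fundamental_tensor L x y' i j) y
                     * \sum_(l < n) y 0 l * Gam x y m l k).

Definition berwald (R : realType) (n : nat) (M : topologicalType)
    (A : smooth_atlas R n M) (F : M -> 'rV[R]_n -> R) : Prop :=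
  forall i : chart A,
    exists Gam : 'rV[R]_n -> 'rV[R]_n -> 'I_n -> 'I_n -> 'I_n -> R,
      chern_connection (local_finsler F i) (chart_img i) Gam /\
      forall x y y', chart_img i x -> y != 0 -> y' != 0 -> Gam x y = Gam x y'.

(* Main.v *)
Require Import Defs.
From HB Require Import structures.
From mathcomp Require Import all_boot all_order all_algebra.
From mathcomp Require Import all_classical all_reals all_analysis.
From mathcomp Require Import ring lra.
Import Order.TTheory GRing.Theory Num.Theory.
Import numFieldNormedType.Exports.
Local Open Scope classical_set_scope.
Local Open Scope ring_scope.
Set Implicit Arguments.
Unset Strict Implicit.
Unset Printing Implicit Defensive.

(** Write alpha = sqrt (g(y, y)) and beta = g(X, y), so that F = alpha + beta.

    Douglas type.  For left-invariant Y and Z the functions beta(Y) and beta(Z)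
    are constant, hence d beta (Y, Z) = - g(X, [Y, Z]), and left-invariant
    fields span every tangent space: beta is closed iff X is orthogonal to all
    brackets ([closed_form_bracket], [douglas_iff]).  The computation is made
    at a point of a chart; that its outcome depends neither on the point nor on
    the chart is the left-invariance of the bracket ([coord_bracket_ltrans]),
    an instance of the naturality of brackets under changes of variables
    ([derive_pushforward]), which rests on the symmetry of second derivatives
    ([schwarz]).

    Berwald type.  In a chart with Gram matrix a and covector b of beta, the
    fundamental tensor is an explicit expression in alpha, beta, y a, b and a
    ([fundamental_tensor_randers]) which is covariant under linear changes of
    coordinates ([drandersG_gl]).  For candidate coefficients Gamma that do not
    depend on y, put
      T = da - (Gamma a + (Gamma a)^T)   and   tau = db - b Gamma^T,
    the obstructions to Gamma preserving g and beta.  Covariance turns the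
    Chern equation into the vanishing of the derivative of the fundamental
    tensor in the direction (T, tau) ([chern_defect]).  Contracting it twice
    with y leaves F (2 tau(y) + T(y, y) / alpha) = 0.  As |X| < 1, F does not
    vanish, and replacing y by -y separates the two terms: T = 0 and tau = 0
    ([berwald_local_iff]).  So F is Berwald iff some torsion-free connection
    preserves both g and beta, that is, iff X is parallel for the Levi-Civita
    connection, that is, iff beta is closed and X is a Killing field: these
    are the skew and the symmetric part of the derivative of X
    ([exists_parallel_connection]).

    In the Lie algebra.  For left-invariant X, being Killing reads
    g([X, Y], Z) + g([X, Z], Y) = 0 ([killing_form_bracket]).  When X is
    orthogonal to the derived algebra, testing this on pairs among e1, e2 and
    the elements u of P yields g(a1, X), g(b2, X), g(a2 + b1, X), g(f1 X, u)
    and g(f2 X, u), up to a factor, and nothing on pairs of elements of P; this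
    is the second equivalence ([killing_iff]). *)

(** * Directional derivatives *)

Section DirectionalCalculus.
Context {R : realType}.
Implicit Types V W : normedModType R.

Lemma growth_line V W (f : V -> W) p w (s : R) :
  (fun h => h^-1 *: (((fun r : R => f (r *: w + p)) \o shift s) (h *: (1 : R))
                     - f (s *: w + p)))
  = (fun h => h^-1 *: ((f \o shift (s *: w + p)) (h *: w) - f (s *: w + p))).
Proof.
apply/funext => h /=; congr (_ *: (f _ - _)).
by rewrite [h *: 1]mulr1 scalerDl addrA.
Qed.

Lemma is_derive_line V (f : V -> R) p w (s : R) :
  derivable f (s *: w + p) w ->
  is_derive s (1 : R) (fun r : R => f (r *: w + p)) ('D_w f (s *: w + p)).
Proof.
move=> df; split; first by rewrite /derivable growth_line.
by rewrite /derive growth_line.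
Qed.

Lemma is_derive_ext V W (f g : V -> W) x v df :
  f =1 g -> is_derive x v f df -> is_derive x v g df.
Proof. by move=> /funext ->. Qed.

Lemma is_derive_mxP V m n (M : V -> 'M[R]_(m, n)) x v dM :
  is_derive x v M dM <->
  forall i j, is_derive x v (fun y => M y i j) (dM i j).
Proof.
split=> [[dv <-] i j|dM'].
  by split; [exact: (derivable_mxP _ _ _).1|rewrite derive_mx// mxE].
have dv : derivable M x v by apply/derivable_mxP => i j; have [] := dM' i j.
split=> //; rewrite derive_mx//; apply/matrixP => i j; rewrite mxE.
by have [] := dM' i j.
Qed.

Lemma is_derive_sumf V W n (h : 'I_n -> V -> W) x v (dh : 'I_n -> W) :
  (forall i, is_derive x v (h i) (dh i)) ->
  is_derive x v (fun y => \sum_(i < n) h i y) (\sum_(i < n) dh i).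
Proof.
move=> /is_derive_sum; rewrite (_ : \sum_(i < n) h i = fun y => \sum_(i < n) h i y)//.
by apply/funext => y; rewrite fct_sumE.
Qed.

Lemma is_derive_mul V (f g : V -> R) x v df dg :
  is_derive x v f df -> is_derive x v g dg ->
  is_derive x v (fun y => f y * g y) (df * g x + f x * dg).
Proof.
move=> hf hg; apply: (@is_derive_eq _ _ _ (f * g)).
by rewrite addrC [df * _]mulrC.
Qed.

Lemma is_derive_diff V W (f : V -> W) x v :
  differentiable f x -> is_derive x v f ('D_v f x).
Proof. by move=> df; exact/derivableP/diff_derivable. Qed.

Lemma derive_comp V W (U : normedModType R) (f : V -> W) (g : W -> U) x v :
  differentiable f x -> differentiable g (f x) ->
  'D_v (g \o f) x = 'D_('D_v f x) g (f x).
Proof.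
move=> df dg; have dgf := differentiable_comp df dg.
by rewrite (deriveE _ dgf) (deriveE _ dg) (deriveE _ df) diff_comp.
Qed.

Lemma derive_linear_dir V W (f : V -> W) x : differentiable f x ->
  linear (fun v => 'D_v f x).
Proof. by move=> df c u v; rewrite !(deriveE _ df) linearP. Qed.

Lemma derive_coord V n (f : V -> 'rV[R]_n) x v i :
  differentiable f x -> 'D_v (fun y => f y 0 i) x = 'D_v f x 0 i.
Proof.
by move=> df; have /is_derive_mxP/(_ 0 i)[] := is_derive_diff v df.
Qed.

Lemma derive_row_dir n W (f : 'rV[R]_n -> W) x (v : 'rV[R]_n) :
  differentiable f x -> 'D_v f x = \sum_j v 0 j *: 'D_(basis_vec R j) f x.
Proof.
move=> df; rewrite deriveE// {1}(row_sum_delta v) linear_sum.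
by apply: eq_bigr => j _; rewrite linearZ deriveE.
Qed.

Lemma differentiable_coordf V n (f : V -> 'rV[R]_n) x i :
  differentiable f x -> differentiable (fun y => f y 0 i : R) x.
Proof.
move=> df; apply: (@differentiable_comp _ _ _ _ f (fun N : 'rV[R]_n => N 0 i))=> //.
exact: differentiable_coord.
Qed.

(** The difference g - f vanishes near x, hence is differentiable there with
    differential 0, and g = f + (g - f). *)
Lemma near_eq_differentiable V W (f g : V -> W) x :
  (\near x, f x = g x) -> differentiable f x -> differentiable g x.
Proof.
move=> fg df.
pose z : {linear V -> W} := \0.
have z0 : (g - f) \o shift x = cst ((g - f) x) + z +o_ 0 id.
  have -> : (g - f) x = 0 by apply/eqP; rewrite subr_eq0 (nbhs_singleton fg).
  apply/eqaddoP => e e0.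
  have fg0 : \forall y \near 0, f (y + x) = g (y + x).
    by move: fg; rewrite (near_shift 0) subr0.
  near=> y.
  have E : f (y + x) = g (y + x) by near: y; exact: fg0.
  by rewrite !fctE /= E subrr addr0 subr0 normr0 mulr_ge0// ltW.
have dgf : differentiable (g - f) x.
  have zc : continuous z by move=> ?; exact: cvg_cst.
  by apply/diff_locallyP; rewrite (diff_unique zc z0).
by rewrite (_ : g = f + (g - f)); [exact: differentiableD|rewrite addrCA subrr addr0].
Unshelve. all: by end_near. Qed.

Lemma open_near V (U : set V) (Q : V -> Prop) x : open U -> U x ->
  (forall y, U y -> Q y) -> \forall y \near x, Q y.
Proof. by move=> oU Ux UQ; apply: filterS UQ _; apply: open_nbhs_nbhs. Qed.

Lemma near_derive_val V W (g f : V -> W) x v df :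
  (\near x, f x = g x) -> is_derive x v g df -> 'D_v f x = df.
Proof. by move=> fg [_ <-]; exact: near_eq_derive. Qed.

Lemma near_neq0 V (y : V) :
  y != 0 -> \forall w \near y, w != 0.
Proof. by move=> y0; apply: (@cvgr_neq0 _ _ _ (nbhs y) _ id y _ y0); exact: cvg_id. Qed.

Lemma is_derive_lineP V (f : V -> R) x v df :
  is_derive x v f df <-> is_derive (0 : R) (1 : R) (fun r : R => f (r *: v + x)) df.
Proof.
have z : 0 *: v + x = x by rewrite scale0r add0r.
split=> -[dv <-]; split.
- by rewrite /derivable growth_line z.
- by rewrite /derive growth_line z.
- by move: dv; rewrite /derivable growth_line z.
- by rewrite /derive growth_line z.
Qed.

(** A directional derivative only sees the restriction to a line, where the
    one-variable chain rule applies. *)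
Lemma is_derive_comp1 V (f : V -> R) (g : R -> R) x v df dg :
  is_derive x v f df -> is_derive (f x) 1 g dg ->
  is_derive x v (fun y => g (f y)) (dg * df).
Proof.
move=> /is_derive_lineP hf hg; apply/is_derive_lineP.
apply: (@is_derive1_comp _ g (fun r => f (r *: v + x))) hf.
by rewrite scale0r add0r.
Qed.

Lemma is_derive_sqrt V (f : V -> R) x v df : 0 < f x ->
  is_derive x v f df ->
  is_derive x v (fun y => Num.sqrt (f y)) ((2 * Num.sqrt (f x))^-1 * df).
Proof. by move=> f0 hf; apply: is_derive_comp1 => //; exact: is_derive1_sqrt. Qed.

Lemma is_derive_inv V (f : V -> R) x v df : f x != 0 ->
  is_derive x v f df ->
  is_derive x v (fun y => (f y)^-1) (- (f x) ^- 2 * df).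
Proof.
by move=> f0 [hf <-]; split; [exact: derivableV|exact: deriveV].
Qed.

Lemma is_derive_add V W (f g : V -> W) x v df dg :
  is_derive x v f df -> is_derive x v g dg ->
  is_derive x v (fun y => f y + g y) (df + dg).
Proof. exact: is_deriveD. Qed.

Lemma is_derive_sub V W (f g : V -> W) x v df dg :
  is_derive x v f df -> is_derive x v g dg ->
  is_derive x v (fun y => f y - g y) (df - dg).
Proof. exact: is_deriveB. Qed.

Lemma is_derive_scalemx V m n (k : V -> R) (f : V -> 'M[R]_(m, n)) x v dk df :
  is_derive x v k dk -> is_derive x v f df ->
  is_derive x v (fun y => k y *: f y) (dk *: f x + k x *: df).
Proof.
move=> hk /is_derive_mxP hf; apply/is_derive_mxP => i j.
rewrite !mxE; apply: is_derive_ext (is_derive_mul hk (hf i j)) => y.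
by rewrite mxE.
Qed.

Lemma is_derive_mulmx V m n p (A : V -> 'M[R]_(m, n)) (B : V -> 'M[R]_(n, p)) x v dA dB :
  is_derive x v A dA -> is_derive x v B dB ->
  is_derive x v (fun y => A y *m B y) (dA *m B x + A x *m dB).
Proof.
move=> /is_derive_mxP hA /is_derive_mxP hB; apply/is_derive_mxP => i j.
rewrite !mxE -big_split /=.
apply: is_derive_ext (is_derive_sumf (fun k => is_derive_mul (hA i k) (hB k j))) => y.
by rewrite mxE.
Qed.

Lemma is_derive_trmx V m n (A : V -> 'M[R]_(m, n)) x v dA :
  is_derive x v A dA -> is_derive x v (fun y => (A y)^T) dA^T.
Proof.
move=> /is_derive_mxP hA; apply/is_derive_mxP => i j; rewrite mxE.
by apply: is_derive_ext (hA j i) => y; rewrite mxE.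
Qed.

End DirectionalCalculus.

(** * Symmetry of second derivatives *)

Section Schwarz.
Context {R : realType} {V : normedModType R}.
Implicit Types (f : V -> R) (u v w p x : V).

Lemma segment_mvt f p w (t : R) : 0 < t ->
  (forall s, 0 <= s <= t -> differentiable f (s *: w + p)) ->
  exists2 c, 0 <= c <= t & f (t *: w + p) - f p = t * 'D_w f (c *: w + p).
Proof.
move=> t0 df.
have dline s : 0 <= s <= t ->
    is_derive s 1 (fun r : R => f (r *: w + p)) ('D_w f (s *: w + p)).
  by move=> /df /diff_derivable - /(_ w)/is_derive_line.
have [||c + E] := @MVT R (fun r => f (r *: w + p))
   (fun s => 'D_w f (s *: w + p)) 0 t t0.
- move=> s; rewrite in_itv /= => /andP[s0 st]; apply: dline.
  by rewrite !ltW.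
- apply: derivable_within_continuous => s; rewrite in_itv /= => st.
  by have [] := dline _ st.
rewrite in_itv /= => /andP[c0 ct]; exists c; first by rewrite !ltW.
by move: E; rewrite scale0r add0r subr0 mulrC.
Qed.

(** Two applications of the mean value theorem: first to
    y |-> f (t v + y) - f y along u, then to 'D_u f along v. *)
Lemma second_difference f x u v (t : R) : 0 < t ->
  (forall c d, 0 <= c <= t -> 0 <= d <= t ->
     differentiable f (c *: u + d *: v + x) /\
     differentiable ('D_u f) (c *: u + d *: v + x)) ->
  exists c d, [/\ 0 <= c <= t, 0 <= d <= t &
    f (t *: u + t *: v + x) - f (t *: u + x) - f (t *: v + x) + f x
    = t * (t * 'D_v ('D_u f) (c *: u + d *: v + x))].
Proof.
move=> t0 df.
have t00 : 0 <= t <= t by rewrite lexx ltW.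
have z0 : 0 <= (0 : R) <= t by rewrite lexx ltW.
pose phi y := f (t *: v + y) - f y.
have dphi c : 0 <= c <= t ->
    differentiable (fun y => f (t *: v + y)) (c *: u + x) /\
    differentiable f (c *: u + x).
  move=> c0; split; last by have [] := df c 0 c0 z0; rewrite scale0r addr0.
  apply: (@differentiable_comp _ _ _ _ (fun y => t *: v + y) f).
    by apply: (@differentiableD _ _ _ (cst (t *: v)) id).
  by have [+ _] := df c t c0 t00; rewrite addrCA addrA.
have [c c0 E1] := @segment_mvt phi x u t t0 (fun c c0 =>
   differentiableB (dphi c c0).1 (dphi c c0).2).
have [d d0 E2] := @segment_mvt ('D_u f) (c *: u + x) v t t0 (fun d d0 =>
  (ltac:(by have [_] := df c d c0 d0; rewrite addrCA addrA) :
     differentiable ('D_u f) (d *: v + (c *: u + x)))).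
exists c, d; split=> //.
have D1 : 'D_u (fun y => f (t *: v + y)) (c *: u + x)
          = 'D_u f (t *: v + (c *: u + x)).
  rewrite /derive (_ : (fun h => _) = fun h => h^-1 *:
    ((f \o shift (t *: v + (c *: u + x))) (h *: u) - f (t *: v + (c *: u + x))))//.
  by apply/funext => h /=; rewrite addrCA.
move: E1; rewrite [X in _ = _ * X]deriveB; last 2 first.
- exact/diff_derivable/(dphi c c0).1.
- exact/diff_derivable/(dphi c c0).2.
rewrite D1 E2 /phi [t *: v + (t *: u + x)]addrCA addrA.
rewrite [d *: v + _]addrCA addrA => <-.
by rewrite opprB; lra.
Qed.

Lemma nbhs_parallelogram x u v (W : set V) : nbhs x W ->
  exists2 t : R, 0 < t & forall c d, 0 <= c <= t -> 0 <= d <= t ->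
    W (c *: u + d *: v + x).
Proof.
move=> /nbhs_ballP[r /= r0 rW].
(* Adding 1 keeps the denominator positive when u = v = 0. *)
have h0 : 0 < `|u| + `|v| + 1 by rewrite ltr_wpDl// addr_ge0.
exists (r / 2 / (`|u| + `|v| + 1)) => [|c d /andP[c0 ct] /andP[d0 dt]].
  by rewrite !divr_gt0.
apply: rW; rewrite -ball_normE /= opprD addrCA subrr addr0 normrN.
rewrite (le_lt_trans (ler_normD _ _))// !normrZ !ger0_norm//.
apply: (@le_lt_trans _ _ (r / 2 / (`|u| + `|v| + 1) * (`|u| + `|v| + 1))).
  rewrite [leRHS]mulrDr mulr1 mulrDr -[leLHS]addr0 lerD// ?lerD// ?ler_wpM2r//.
  by rewrite !divr_ge0 ?ltW.
by rewrite divfK ?gt_eqF// ltr_pdivrMr// ltr_pMr// ltr1n.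
Qed.

(** The second difference of f on a small parallelogram is symmetric in u and v
    and, by [second_difference], equals t^2 times a value of either mixed
    derivative near x; let the parallelogram shrink. *)
Lemma schwarz f x u v :
  (\forall y \near x, differentiable f y) ->
  (\forall y \near x, differentiable ('D_u f) y) ->
  (\forall y \near x, differentiable ('D_v f) y) ->
  {for x, continuous ('D_v ('D_u f))} ->
  {for x, continuous ('D_u ('D_v f))} ->
  'D_v ('D_u f) x = 'D_u ('D_v f) x.
Proof.
move=> df du dv cvu cuv; apply/eqP; rewrite -subr_eq0 -normr_le0.
apply/ler_addgt0Pl => e e0; rewrite addr0.
have e2 : 0 < e / 2 by rewrite divr_gt0.
move/cvgrPdist_lt/(_ _ e2) : cvu => cvu.
move/cvgrPdist_lt/(_ _ e2) : cuv => cuv.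
have [t t0 tW] := nbhs_parallelogram u v
  (filterI df (filterI du (filterI dv (filterI cvu cuv)))).
have [|c [d [c0 d0 E1]]] := @second_difference f x u v t t0.
  by move=> c d c0 d0; have [? [? _]] := tW c d c0 d0; split.
have [|c' [d' [c'0 d'0 E2]]] := @second_difference f x v u t t0.
  move=> c' d' c0' d0'; rewrite [c' *: v + _]addrC.
  by have [? [_ [? _]]] := tW d' c' d0' c0'; split.
have [_ [_ [_ [A1 _]]]] := tW c d c0 d0.
have [_ [_ [_ [_ A2]]]] := tW d' c' d'0 c'0.
have tn0 : t != 0 by rewrite gt_eqF.
move: E2; rewrite [t *: v + t *: u]addrC [X in X + f x]addrAC E1.
move=> /(mulfI tn0)/(mulfI tn0) E.
rewrite [c' *: v + _]addrC in E.
rewrite -E in A2.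
have /le_trans := ler_distD ('D_v ('D_u f) (c *: u + d *: v + x))
  ('D_v ('D_u f) x) ('D_u ('D_v f) x).
apply; rewrite distrC in A2; rewrite (splitr e).
exact: (lerD (ltW A1) (ltW A2)).
Qed.

End Schwarz.

(** * Functions of class C^k *)

Section ClassCk.
Context {R : realType}.
Implicit Types V W : normedModType R.

Lemma Ck_on_eq V W k (U : set V) (f g : V -> W) : open U ->
  (forall x, U x -> f x = g x) -> Ck_on k U f -> Ck_on k U g.
Proof.
move=> oU.
have near_U (f' g' : V -> W) : (forall x, U x -> f' x = g' x) ->
    forall x, U x -> \near x, f' x = g' x.
  by move=> fg x Ux; apply: open_near oU Ux fg.
elim: k f g => [|k IHk] f g fg /=.
  move=> cf x Ux; move: (cf x Ux); rewrite /prop_for /continuous_at -(fg x Ux) => cfx.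
  apply: cvg_trans cfx; apply: near_eq_cvg.
  exact: near_U.
move=> [df dDf]; split.
  by move=> x Ux; apply: near_eq_differentiable (df x Ux); exact: near_U.
move=> v; apply: IHk (dDf v) => x Ux.
by apply: near_eq_derive; exact: near_U.
Qed.

Lemma Ck_onS V W k (U U' : set V) (f : V -> W) : U' `<=` U ->
  Ck_on k U f -> Ck_on k U' f.
Proof.
move=> sU; elim: k f => [|k IHk] f /=; first by move=> cf x /sU; exact: cf.
by move=> [df dDf]; split=> [x /sU|v]; [exact: df|exact: IHk].
Qed.

(** Both sides are limits of the same difference quotient. *)
Lemma derive_sliceL V V' W (f : V * V' -> W) b x v :
  'D_v (fun y => f (y, b)) x = 'D_(v, 0) f (x, b).
Proof.
rewrite /derive (_ : (fun h => _) = fun h => h^-1 *: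
    ((f \o shift (x, b)) (h *: (v, 0 : V')) - f (x, b)))//.
apply/funext => h /=; congr (_ *: (f _ - _)).
by apply/pair_equal_spec; split=> //=; rewrite scaler0 add0r.
Qed.

Lemma derive_sliceR V V' W (f : V * V' -> W) a x v :
  'D_v (fun y => f (a, y)) x = 'D_(0, v) f (a, x).
Proof.
rewrite /derive (_ : (fun h => _) = fun h => h^-1 *:
    ((f \o shift (a, x)) (h *: (0 : V, v)) - f (a, x)))//.
apply/funext => h /=; congr (_ *: (f _ - _)).
by apply/pair_equal_spec; split=> //=; rewrite scaler0 add0r.
Qed.

Lemma Ck_on_sliceL V V' W k (U : set (V * V')) (f : V * V' -> W) b :
  Ck_on k U f -> Ck_on k [set x | U (x, b)] (fun x => f (x, b)).
Proof.
elim: k f => [|k IHk] f /=.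
  move=> cf x /cf; apply: (@continuous_comp _ _ _ (fun y => (y, b)) f).
  by apply: cvg_pair => //=; exact: cvg_cst.
move=> [df dDf]; split.
  move=> x /df; apply: (@differentiable_comp _ _ _ _ (fun y => (y, b)) f).
  exact: differentiable_pair.
move=> v; rewrite (_ : (fun x => _) = fun x => 'D_(v, 0) f (x, b)).
  exact: (IHk _ (dDf (v, 0))).
by apply/funext => x; rewrite derive_sliceL.
Qed.

Lemma Ck_on_sliceR V V' W k (U : set (V * V')) (f : V * V' -> W) a :
  Ck_on k U f -> Ck_on k [set x | U (a, x)] (fun x => f (a, x)).
Proof.
elim: k f => [|k IHk] f /=.
  move=> cf x /cf; apply: (@continuous_comp _ _ _ (fun y => (a, y)) f).
  by apply: cvg_pair => //=; exact: cvg_cst.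
move=> [df dDf]; split.
  move=> x /df; apply: (@differentiable_comp _ _ _ _ (fun y => (a, y)) f).
  exact: differentiable_pair.
move=> v; rewrite (_ : (fun x => _) = fun x => 'D_(0, v) f (a, x)).
  exact: (IHk _ (dDf (0, v))).
by apply/funext => x; rewrite derive_sliceR.
Qed.

(** Coordinatewise reduction to the scalar case. *)
Lemma C2_on_schwarz V n (U : set V) (f : V -> 'rV[R]_n) x u v : open U -> U x ->
  Ck_on 2 U f -> 'D_v ('D_u f) x = 'D_u ('D_v f) x.
Proof.
move=> oU Ux [df dDf].
have Unear P := @open_near _ _ _ P _ oU Ux.
have dD w y : U y -> differentiable ('D_w f) y by case: (dDf w) => + _; apply.
have cDD w w' : {for x, continuous ('D_w' ('D_w f))}.
  by case: (dDf w) => _ /(_ w'); apply.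
apply/rowP => i.
have D1 w : forall y, U y -> 'D_w (fun y => f y 0 i) y = 'D_w f y 0 i.
  by move=> y Uy; rewrite derive_coord//; exact: df.
have D2 w w' y : U y ->
    'D_w' ('D_w (fun y => f y 0 i)) y = 'D_w' ('D_w f) y 0 i.
  move=> Uy; rewrite -derive_coord; last exact: dD.
  by apply: near_eq_derive; apply: open_near oU Uy _; exact: D1.
have d2 w : \forall y \near x, differentiable ('D_w (fun y => f y 0 i)) y.
  apply: Unear => y Uy.
  apply: (near_eq_differentiable (f := fun y => 'D_w f y 0 i)).
    by apply: open_near oU Uy _ => z Uz; rewrite D1.
  by apply: differentiable_coordf; exact: dD.
have c2 w w' : {for x, continuous ('D_w' ('D_w (fun y => f y 0 i)))}.
  have cDDi : {for x, continuous (fun y => 'D_w' ('D_w f) y 0 i : R)}.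
    apply: (@continuous_comp _ _ _ ('D_w' ('D_w f)) (fun M : 'rV[R]_n => M 0 i)) => //.
    exact: coord_continuous.
  rewrite /prop_for /continuous_at D2//.
  apply: cvg_trans cDDi; apply: near_eq_cvg.
  by apply: Unear => y Uy; rewrite D2.
have dfi : \forall y \near x, differentiable (fun y => f y 0 i : R) y.
  by apply: Unear => y Uy; apply: differentiable_coordf; exact: df.
have E := schwarz dfi (d2 u) (d2 v) (c2 u v) (c2 v u).
exact: (etrans (esym (D2 u v x Ux)) (etrans E (D2 v u x Ux))).
Qed.

End ClassCk.

(** * Coordinate brackets and changes of variables *)

Section Pushforward.
Context {R : realType} {n : nat}.

(** Product rule for the differential of phi applied to the field Z, obtained by
    expanding Z in the standard basis. *)
Lemma derive_along_field (U : set 'rV[R]_n) (phi Z : 'rV[R]_n -> 'rV[R]_n) x v :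
  open U -> U x -> Ck_on 2 U phi -> differentiable Z x ->
  'D_v (fun y => 'D_(Z y) phi y) x
  = 'D_('D_v Z x) phi x + 'D_v ('D_(Z x) phi) x.
Proof.
move=> oU Ux [dphi dDphi] dZ.
have dD w : differentiable ('D_w phi) x by case: (dDphi w) => + _; apply.
pose E (j : 'I_n) := basis_vec R j.
have Unear P := @open_near _ _ _ P _ oU Ux.
have E1 : \forall y \near x, 'D_(Z y) phi y = \sum_j Z y 0 j *: 'D_(E j) phi y.
  by apply: Unear => y Uy; rewrite -derive_row_dir//; exact: dphi.
apply: etrans (near_eq_derive _ E1) _.
have E2 : \forall y \near x, 'D_(Z x) phi y = \sum_j Z x 0 j *: 'D_(E j) phi y.
  by apply: Unear => y Uy; rewrite -derive_row_dir//; exact: dphi.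
apply: etrans _ (esym (congr1 (fun w => _ + w) (near_eq_derive v E2))).
rewrite (derive_row_dir ('D_v Z x)); last exact: dphi.
have S1 := is_derive_sumf (fun j => is_derive_scalemx
  (is_derive_diff v (differentiable_coordf j dZ)) (is_derive_diff v (dD (E j)))).
have S2 := is_derive_sumf (fun j => is_derive_scalemx
  (is_derive_cst (Z x 0 j) x v) (is_derive_diff v (dD (E j)))).
rewrite [LHS](@derive_val _ _ _ _ _ _ _ S1).
rewrite [X in _ = _ + X](@derive_val _ _ _ _ _ _ _ S2) -big_split /=.
by apply: eq_bigr => j _; rewrite derive_coord// scale0r add0r.
Qed.

(** naturality *)
(** Naturality of the Lie bracket: if phi maps Y to Y' and Z to Z', it maps
    [Y, Z] to [Y', Z'].  Differentiating Z' o phi = d phi (Z) along Y gives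
    d phi (D_Y Z) plus the second derivative of phi at (Y, Z), and the latter
    cancels in the commutator by symmetry. *)
Lemma derive_pushforward (U : set 'rV[R]_n) (phi Y Z Y' Z' : 'rV[R]_n -> 'rV[R]_n) x :
  open U -> U x -> Ck_on 2 U phi ->
  (forall y, U y -> Y' (phi y) = 'D_(Y y) phi y) ->
  (forall y, U y -> Z' (phi y) = 'D_(Z y) phi y) ->
  differentiable Y x -> differentiable Z x ->
  differentiable Y' (phi x) -> differentiable Z' (phi x) ->
  'D_(Y' (phi x)) Z' (phi x) - 'D_(Z' (phi x)) Y' (phi x)
  = 'D_('D_(Y x) Z x - 'D_(Z x) Y x) phi x.
Proof.
move=> oU Ux C2 rY rZ dY dZ dY' dZ'.
have dphi : differentiable phi x by case: C2 => + _; apply.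
have half (A B A' B' : 'rV[R]_n -> 'rV[R]_n) : A' (phi x) = 'D_(A x) phi x ->
    (forall y, U y -> B' (phi y) = 'D_(B y) phi y) ->
    differentiable B x -> differentiable B' (phi x) ->
    'D_(A' (phi x)) B' (phi x) = 'D_('D_(A x) B x) phi x + 'D_(A x) ('D_(B x) phi) x.
  move=> rA rB dB dB'; rewrite -(derive_along_field (A x) oU Ux C2 dB) rA -derive_comp//.
  by apply: near_eq_derive; apply: open_near oU Ux rB.
rewrite (half Y Z Y' Z')//; last exact: rY.
rewrite (half Z Y Z' Y')//; last exact: rZ.
have key (a b c d : 'rV[R]_n) : c = d -> a + c - (b + d) = a - b.
  by move=> ->; rewrite opprD addrACA subrr addr0.
rewrite (key _ _ _ _ (C2_on_schwarz (Z x) (Y x) oU Ux C2)).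
by rewrite -(linearB (HB.pack (fun v => 'D_v phi x)
   (GRing.isLinear.Build _ _ _ _ _ (derive_linear_dir dphi)))).
Qed.

End Pushforward.

(** * Bilinear forms in coordinates *)

Definition bil (R : pzRingType) (n : nat) (M : 'M[R]_n) (u v : 'rV[R]_n) : R :=
  (u *m M *m v^T) 0 0.

Definition dot (R : pzRingType) (n : nat) (u v : 'rV[R]_n) : R := (u *m v^T) 0 0.

Section Bil.
Context {R : realType} {n : nat}.
Implicit Types (M N : 'M[R]_n) (u v w : 'rV[R]_n).

Lemma bilE M u v : bil M u v = dot (u *m M) v. Proof. by []. Qed.
Lemma dotC u v : dot u v = dot v u.
Proof. by rewrite /dot !mxE; apply: eq_bigr => k _; rewrite !mxE mulrC. Qed.
Lemma bil_tr M u v : bil M^T u v = bil M v u.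
Proof. by rewrite bilE dotC /dot trmx_mul trmxK mulmxA. Qed.
Lemma bilDm M N u v : bil (M + N) u v = bil M u v + bil N u v.
Proof. by rewrite /bil mulmxDr mulmxDl mxE. Qed.
Lemma bilNm M u v : bil (- M) u v = - bil M u v.
Proof. by rewrite /bil mulmxN mulNmx mxE. Qed.
Lemma bilZm c M u v : bil (c *: M) u v = c * bil M u v.
Proof. by rewrite /bil -scalemxAr -scalemxAl mxE. Qed.
Lemma bilDl M u v w : bil M (u + v) w = bil M u w + bil M v w.
Proof. by rewrite /bil !mulmxDl mxE. Qed.
Lemma bilDr M u v w : bil M u (v + w) = bil M u v + bil M u w.
Proof. by rewrite /bil linearD mulmxDr mxE. Qed.
Lemma bilZl c M u v : bil M (c *: u) v = c * bil M u v.
Proof. by rewrite /bil -!scalemxAl mxE. Qed.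
Lemma bilZr c M u v : bil M u (c *: v) = c * bil M u v.
Proof. by rewrite /bil linearZ -scalemxAr mxE. Qed.
Lemma bilNl M u v : bil M (- u) v = - bil M u v.
Proof. by rewrite -scaleN1r bilZl mulN1r. Qed.
Lemma bilNr M u v : bil M u (- v) = - bil M u v.
Proof. by rewrite -scaleN1r bilZr mulN1r. Qed.
Lemma dotDl u v w : dot (u + v) w = dot u w + dot v w.
Proof. by rewrite /dot mulmxDl mxE. Qed.
Lemma dotZl c u v : dot (c *: u) v = c * dot u v.
Proof. by rewrite /dot -scalemxAl mxE. Qed.
Lemma dotNl u v : dot (- u) v = - dot u v.
Proof. by rewrite /dot mulNmx mxE. Qed.
Lemma dotNr u v : dot u (- v) = - dot u v.
Proof. by rewrite /dot linearN mulmxN mxE. Qed.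
Lemma bil0m u v : bil 0 u v = 0 :> R.
Proof. by rewrite /bil mulmx0 mul0mx mxE. Qed.
Lemma bil0l M u : bil M 0 u = 0.
Proof. by rewrite /bil !mul0mx mxE. Qed.
Lemma bil0r M u : bil M u 0 = 0.
Proof. by rewrite /bil trmx0 mulmx0 mxE. Qed.
Lemma dot0l u : dot 0 u = 0 :> R.
Proof. by rewrite /dot mul0mx mxE. Qed.
Lemma dot0r u : dot u 0 = 0 :> R.
Proof. by rewrite dotC dot0l. Qed.
Lemma bil_rank1 u w v : bil (u^T *m w) v v = dot u v * dot w v.
Proof.
rewrite /bil mulmxA -mulmxA mxE big_ord1; congr (_ * _).
by rewrite -/(dot v u) dotC.
Qed.
Lemma dot_delta u i : dot u (basis_vec R i) = u 0 i.
Proof. by rewrite /dot /basis_vec trmx_delta -colE mxE. Qed.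
Lemma bil_delta M i j : bil M (basis_vec R i) (basis_vec R j) = M i j.
Proof. by rewrite bilE dot_delta /basis_vec -rowE mxE. Qed.

Lemma sym_bil0 M : M^T = M -> (forall y, y != 0 -> bil M y y = 0) -> M = 0.
Proof.
move=> sM M0.
have M00 y : bil M y y = 0.
  by have [->|/M0//] := eqVneq y 0; rewrite /bil !mul0mx mxE.
apply/matrixP => i j; rewrite mxE -bil_delta.
have := M00 (basis_vec R i + basis_vec R j).
rewrite bilDl !bilDr !M00 -[X in _ + (X + _)]bil_tr sM; lra.
Qed.

(** Positivity on bil M v v *: u - bil M u v *: v. *)
Lemma cauchy_schwarz M u v : M^T = M ->
  (forall y, y != 0 -> 0 < bil M y y) -> v != 0 ->
  bil M u v ^+ 2 <= bil M u u * bil M v v.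
Proof.
move=> sM pM v0; have vv := pM v v0.
have bil_ge0 y : 0 <= bil M y y.
  by have [->|/pM/ltW//] := eqVneq y 0; rewrite bil0l.
have := bil_ge0 (bil M v v *: u - bil M u v *: v).
rewrite bilDl !bilDr !bilNl !bilNr !bilZl !bilZr -[bil M v u]bil_tr sM.
move=> h; suff : 0 <= bil M v v * (bil M u u * bil M v v - bil M u v ^+ 2).
  by rewrite pmulr_rge0// subr_ge0.
by apply: le_trans h _; rewrite le_eqVlt; apply/orP; left; apply/eqP; ring.
Qed.

Lemma basis_vec_neq0 i : basis_vec R i != 0 :> 'rV[R]_n.
Proof.
apply/eqP => /matrixP/(_ 0 i); rewrite !mxE !eqxx => /eqP.
by rewrite oner_eq0.
Qed.
End Bil.

Section DeriveBil.
Context {R : realType} {n : nat}.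

Lemma is_derive_dot (V : normedModType R) (u w : V -> 'rV[R]_n) x v du dw :
  is_derive x v u du -> is_derive x v w dw ->
  is_derive x v (fun z => dot (u z) (w z)) (dot du (w x) + dot (u x) dw).
Proof.
move=> hu hw; have /is_derive_mxP/(_ 0 0) := is_derive_mulmx hu (is_derive_trmx hw).
by move/is_derive_eq; apply; rewrite mxE.
Qed.

Lemma is_derive_bil (V : normedModType R) (M : V -> 'M[R]_n)
    (u w : V -> 'rV[R]_n) x v dM du dw :
  is_derive x v M dM -> is_derive x v u du -> is_derive x v w dw ->
  is_derive x v (fun z => bil (M z) (u z) (w z))
    (bil dM (u x) (w x) + bil (M x) du (w x) + bil (M x) (u x) dw).
Proof.
move=> hM hu hw; apply: is_derive_eq (is_derive_dot (is_derive_mulmx hu hM) hw) _.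
by rewrite dotDl -!bilE [bil (M x) du _ + _]addrC.
Qed.
End DeriveBil.

Section BilinearBasis.
Context {R : realType} {n : nat}.

Lemma linear0_basis (f : 'rV[R]_n -> R) :
  (forall c u v, f (c *: u + v) = c * f u + f v) ->
  (forall a, f (basis_vec R a) = 0) -> forall v, f v = 0.
Proof.
move=> fl f0 v.
have f00 : f 0 = 0 by have := fl 1 0 0; rewrite scaler0 addr0; lra.
rewrite (row_sum_delta v); elim/big_ind: _ => // [u w fu fw|a _].
  by rewrite -[u]scale1r fl fu fw mulr0 addr0.
by rewrite -[_ *: _]addr0 fl f0 f00 mulr0 addr0.
Qed.

Lemma bilinear0_basis (B : 'rV[R]_n -> 'rV[R]_n -> R) :
  (forall c u v w, B (c *: u + v) w = c * B u w + B v w) ->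
  (forall c u v w, B w (c *: u + v) = c * B w u + B w v) ->
  (forall a b, B (basis_vec R a) (basis_vec R b) = 0) -> forall v w, B v w = 0.
Proof.
move=> Bl Br B0 v w; apply: (@linear0_basis (B ^~ w)) => [c u u'|a]; first exact: Bl.
by apply: (@linear0_basis (B (basis_vec R a))) => // c u u'; exact: Br.
Qed.

Lemma dot_skew_basis (D : 'rV[R]_n -> 'rV[R]_n) : linear D ->
  (forall a b, D (basis_vec R a) 0 b = D (basis_vec R b) 0 a) ->
  forall v w, dot (D v) w - dot (D w) v = 0.
Proof.
move=> Dl D0; apply: bilinear0_basis => [c u v w|c u v w|a b].
- rewrite Dl dotDl dotZl ![dot (D w) _]dotC dotDl dotZl; ring.
- rewrite Dl dotDl dotZl ![dot (D w) _]dotC dotDl dotZl; ring.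
- by rewrite !dot_delta (D0 a b) subrr.
Qed.

Lemma bil_sym_basis (D : 'rV[R]_n -> 'rV[R]_n) (M N : 'M[R]_n) : linear D ->
  (forall a b, bil N (basis_vec R a) (basis_vec R b)
     + bil M (D (basis_vec R a)) (basis_vec R b)
     + bil M (D (basis_vec R b)) (basis_vec R a) = 0) ->
  forall v w, bil N v w + bil M (D v) w + bil M (D w) v = 0.
Proof.
move=> Dl; apply: bilinear0_basis => c u v w.
- by rewrite Dl !(bilDl, bilDr, bilZl, bilZr); ring.
- by rewrite Dl !(bilDl, bilDr, bilZl, bilZr); ring.
Qed.
End BilinearBasis.

(** * The fundamental tensor of a Randers metric *)

Section FundamentalTensor.
Context {R : realType} {n : nat}.
Implicit Types (q be : R) (M K : 'M[R]_n) (U B y : 'rV[R]_n).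

(** Throughout this part q stands for alpha, be for beta(y), U for the row y a,
    B for the covector b and M for the Gram matrix a.  The gradient of F in y is
    then U / q + B. *)
Definition gradL q U B : 'rV[R]_n := q^-1 *: U + B.
(** An argument prefixed with d is the velocity of its namesake, here and in
    [drandersG]. *)
Definition dgradL q U dq dU dB : 'rV[R]_n :=
  q^-1 *: dU - (dq / q ^+ 2) *: U + dB.

(** Half the Hessian of F^2 in y. *)
Definition randersG q be U B M : 'M[R]_n :=
  (gradL q U B)^T *m gradL q U B
  + ((q + be) / q) *: (M - q ^- 2 *: (U^T *m U)).

Definition drandersG q be U B M dq dbe dU dB dM : 'M[R]_n :=
  (dgradL q U dq dU dB)^T *m gradL q U B
  + (gradL q U B)^T *m dgradL q U dq dU dB
  + (dbe / q - be * dq / q ^+ 2) *: (M - q ^- 2 *: (U^T *m U))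
  + ((q + be) / q) *: (dM - q ^- 2 *: (dU^T *m U + U^T *m dU)
                        + (2 * dq / q ^+ 3) *: (U^T *m U)).

Lemma gradL_coord q U B i :
  gradL q U B 0 i = q^-1 * U 0 i + B 0 i.
Proof. by rewrite !mxE. Qed.

Lemma randersG_coord q be U B M i j :
  randersG q be U B M i j = gradL q U B 0 i * gradL q U B 0 j
    + (q + be) / q * (M i j - q ^- 2 * (U 0 i * U 0 j)).
Proof. by rewrite /randersG; move: (gradL q U B) => F; rewrite !mxE !big_ord1 !mxE. Qed.

Lemma eq_drandersG q be U B M
    dq dbe dU dB dM dq' dbe' dU' dB' dM' :
  dq = dq' -> dbe = dbe' -> dU = dU' -> dB = dB' -> dM = dM' ->
  drandersG q be U B M dq dbe dU dB dM = drandersG q be U B M dq' dbe' dU' dB' dM'.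
Proof. by move=> -> -> -> -> ->. Qed.

Lemma is_derive_randersG (V : normedModType R) (q be : V -> R)
    (U B : V -> 'rV[R]_n) (M : V -> 'M[R]_n) x v dq dbe dU dB dM :
  q x != 0 ->
  is_derive x v q dq -> is_derive x v be dbe -> is_derive x v U dU ->
  is_derive x v B dB -> is_derive x v M dM ->
  is_derive x v (fun z => randersG (q z) (be z) (U z) (B z) (M z))
    (drandersG (q x) (be x) (U x) (B x) (M x) dq dbe dU dB dM).
Proof.
move=> q0 hq hbe hU hB hM.
have hi := is_derive_inv q0 hq.
have hW := is_derive_add (is_derive_scalemx hi hU) hB.
have hW2 := is_derive_mulmx (is_derive_trmx hW) hW.
have hU2 := is_derive_mulmx (is_derive_trmx hU) hU.
have hc := is_derive_mul (is_derive_add hq hbe) hi.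
have hi2 := is_derive_mul hi hi.
have h := is_derive_add hW2
   (is_derive_scalemx hc (is_derive_sub hM (is_derive_scalemx hi2 hU2))).
apply: is_derive_eq.
  by apply: is_derive_ext h => z; rewrite /randersG /gradL -expr2 exprVn.
apply/matrixP => i j; rewrite /drandersG /dgradL /gradL !mxE !big_ord1 !mxE; field.
exact: q0.
Qed.

Lemma drandersG_linear q be U B M c dq dbe dU dB dM dq' dbe' dU' dB' dM' :
  q != 0 ->
  drandersG q be U B M (c * dq + dq') (c * dbe + dbe')
    (c *: dU + dU') (c *: dB + dB') (c *: dM + dM')
  = c *: drandersG q be U B M dq dbe dU dB dM
    + drandersG q be U B M dq' dbe' dU' dB' dM'.
Proof.
move=> q0.
by apply/matrixP => i j; rewrite /drandersG /dgradL /gradL !mxE !big_ord1 !mxE; field.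
Qed.

Lemma drandersGD q be U B M dq dbe dU dB dM dq' dbe' dU' dB' dM' :
  q != 0 ->
  drandersG q be U B M (dq + dq') (dbe + dbe') (dU + dU') (dB + dB') (dM + dM')
  = drandersG q be U B M dq dbe dU dB dM
    + drandersG q be U B M dq' dbe' dU' dB' dM'.
Proof.
move=> q0; have := drandersG_linear be U B M 1 dq dbe dU dB dM dq' dbe' dU' dB' dM' q0.
by rewrite !mul1r !scale1r.
Qed.

Lemma drandersG0 q be U B M : drandersG q be U B M 0 0 0 0 0 = 0.
Proof.
rewrite /drandersG /dgradL.
by rewrite !(mul0r, mulr0, scale0r, scaler0, subr0, addr0, trmx0, mul0mx, mulmx0).
Qed.

(** Covariance of the fundamental tensor under the linear group, in
    infinitesimal form: a change of coordinates generated by K moves (U, B, M) by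
    (U K, B K, K^T M + M K) and leaves alpha and beta(y) alone. *)
Lemma drandersG_gl q be U B M K :
  drandersG q be U B M 0 0 (U *m K) (B *m K) (K^T *m M + M *m K)
  = K^T *m randersG q be U B M + randersG q be U B M *m K.
Proof.
have dF : dgradL q U 0 (U *m K) (B *m K) = gradL q U B *m K.
  by rewrite /dgradL /gradL mul0r scale0r subr0 mulmxDl scalemxAl.
rewrite /drandersG dF /randersG !(mulr0, mul0r) subr0 !scale0r !addr0.
rewrite !trmx_mul mulmxDr mulmxDl -!mulmxA [RHS]addrACA; congr (_ + _).
rewrite -scalemxAl -scalemxAr -scalerDr; congr (_ *: _).
rewrite mulmxBr mulmxBl -scalemxAl -scalemxAr -!mulmxA scalerDr opprD.
by rewrite addrACA.
Qed.

(** While y is fixed and M and B move with velocities T and tau, the contraction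
    of the fundamental tensor with y twice is F^2, and 2 F times the derivative of
    F is its derivative; t / (2 * q) is the derivative of alpha. *)
Lemma bil_drandersG q be U B M y T t tau :
  q != 0 -> dot U y = q ^+ 2 -> bil M y y = q ^+ 2 -> dot B y = be ->
  dot (y *m T) y = t ->
  bil (drandersG q be U B M (t / (2 * q)) (dot tau y) (y *m T) tau T) y y
  = (q + be) * (2 * dot tau y + t / q).
Proof.
move=> q0 Uy My By Ty.
have Fy : dot (gradL q U B) y = q + be.
  by rewrite dotDl dotZl Uy By expr2 mulKf.
have dFy : dot (dgradL q U (t / (2 * q)) (y *m T) tau) y
    = t / (2 * q) + dot tau y.
  rewrite /dgradL dotDl -scaleNr dotDl !dotZl Uy Ty; field.
  exact: q0.
rewrite /drandersG !(bilDm, bilZm, bilNm) !bil_rank1 Fy dFy Uy My (bilE T) Ty.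
field.
exact: q0.
Qed.
End FundamentalTensor.

(** * Berwald Randers metrics in a chart *)

(** The matrix of the k-th connection form, with which Gamma^m_lk y^l becomes
    the m-th entry of y *m conn_mx Gam k. *)
Definition conn_mx (R : realType) n (Gam : 'I_n -> 'I_n -> 'I_n -> R) k
    : 'M[R]_n :=
  \matrix_(i, m) Gam m i k.

Section LocalRanders.
Context {R : realType} {n : nat}.
Context (U : set 'rV[R]_n) (a : 'rV[R]_n -> 'M[R]_n) (b : 'rV[R]_n -> 'rV[R]_n).
Context (oU : open U).
Context (a_sym : forall x, U x -> (a x)^T = a x).
Context (a_pos : forall x y, U x -> y != 0 -> 0 < bil (a x) y y).
Context (da : forall x v, U x -> derivable a x v).
Context (db : forall x v, U x -> derivable b x v).

Let q x y := Num.sqrt (bil (a x) y y).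
Let L x y : R := q x y + dot (b x) y.
Context (L_neq0 : forall x y, U x -> y != 0 -> L x y != 0).

Let G x y := randersG (q x y) (dot (b x) y) (y *m a x) (b x) (a x).
Let E (i : 'I_n) : 'rV[R]_n := basis_vec R i.

Let qgt0 x y : U x -> y != 0 -> 0 < q x y.
Proof. by move=> Ux y0; rewrite sqrtr_gt0 a_pos. Qed.

Let qsq x y : U x -> y != 0 -> q x y ^+ 2 = bil (a x) y y.
Proof. by move=> Ux y0; rewrite sqr_sqrtr// ltW// a_pos. Qed.

Let is_derive_qy x y v : U x -> y != 0 ->
  is_derive y v (q x) ((2 * q x y)^-1 * (bil (a x) v y + bil (a x) y v)).
Proof.
move=> Ux y0; apply: is_derive_sqrt; first exact: a_pos.
apply: is_derive_eq (is_derive_bil (is_derive_cst (a x) y v)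
  (is_derive_id y v) (is_derive_id y v)) _.
by rewrite /bil mulmx0 mul0mx [X in X + _ + _]mxE add0r.
Qed.

Let is_derive_by x y v : is_derive y v (dot (b x)) (dot (b x) v).
Proof.
apply: is_derive_eq (is_derive_dot (is_derive_cst (b x) y v) (is_derive_id y v)) _.
by rewrite /dot mul0mx mxE add0r.
Qed.

Let is_derive_Uy x (y v : 'rV[R]_n) : is_derive y v (fun w => w *m a x) (v *m a x).
Proof.
apply: is_derive_eq (is_derive_mulmx (is_derive_id y v) (is_derive_cst (a x) y v)) _.
by rewrite mulmx0 addr0.
Qed.

Let bil_sym x u v : U x -> bil (a x) u v = bil (a x) v u.
Proof. by move=> Ux; rewrite -[LHS]bil_tr a_sym. Qed.

Let is_derive_L2 x y i : U x -> y != 0 ->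
  is_derive y (E i) (fun w => L x w ^+ 2)
    (2 * (L x y * gradL (q x y) (y *m a x) (b x) 0 i)).
Proof.
move=> Ux y0.
have hL := is_derive_add (is_derive_qy (E i) Ux y0) (is_derive_by x y (E i)).
apply: is_derive_ext (fun w => esym (expr2 (L x w))) _.
apply: is_derive_eq (is_derive_mul hL hL) _.
rewrite gradL_coord -(dot_delta (y *m a x)) -bilE -(dot_delta (b x)) -/(E i).
rewrite [bil _ (E i) _]bil_sym// /L; field.
by rewrite gt_eqF// qgt0.
Qed.

Lemma fundamental_tensor_randers x y i j : U x -> y != 0 ->
  fundamental_tensor L x y i j = G x y i j.
Proof.
move=> Ux y0; rewrite /fundamental_tensor.
have E1 : \forall w \near y, 'D_(E j) (fun w' => L x w' ^+ 2) w =
    2 * (L x w * gradL (q x w) (w *m a x) (b x) 0 j).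
  have : \forall w \near y, w != 0 by exact: near_neq0.
  by apply: filterS => w w0; have [] := is_derive_L2 j Ux w0.
have qn0 : q x y != 0 by rewrite gt_eqF// qgt0.
have hq := is_derive_qy (E i) Ux y0.
have hL := is_derive_add hq (is_derive_by x y (E i)).
have hF : is_derive y (E i) (fun w => gradL (q x w) (w *m a x) (b x) 0 j)
    (- q x y ^- 2 * ((2 * q x y)^-1 * (bil (a x) (E i) y + bil (a x) y (E i)))
       * (y *m a x) 0 j + (q x y)^-1 * a x i j).
  have /is_derive_mxP/(_ 0 j) := is_derive_add (is_derive_scalemx
    (is_derive_inv qn0 hq) (is_derive_Uy x y (E i))) (is_derive_cst (b x) y (E i)).
  move/is_derive_eq; apply.
  have -> : E i *m a x = row i (a x) by rewrite /E /basis_vec -rowE.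
  have coord c d (u v : 'rV[R]_n) : (c *: u + d *: v) 0 j = c * u 0 j + d * v 0 j.
    by rewrite !mxE.
  by rewrite addr0 coord [row i _ 0 j]mxE.
have h := is_derive_mul (is_derive_cst (2 : R) y (E i)) (is_derive_mul hL hF).
rewrite (near_derive_val E1 h).
rewrite /G randersG_coord !gradL_coord [bil _ (E i) _]bil_sym//.
rewrite (bilE _ y) /E !dot_delta /cst /L; field.
exact: qn0.
Qed.

(** [dGy] is the derivative of the fundamental tensor in y along v, and [dGx] the
    one in x along the k-th coordinate. *)
Let dGy x y v := drandersG (q x y) (dot (b x) y) (y *m a x) (b x) (a x)
  ((2 * q x y)^-1 * (bil (a x) v y + bil (a x) y v)) (dot (b x) v) (v *m a x) 0 0.

Let dGx x y k := drandersG (q x y) (dot (b x) y) (y *m a x) (b x) (a x)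
  ((2 * q x y)^-1 * bil ('D_(E k) a x) y y) (dot ('D_(E k) b x) y)
  (y *m 'D_(E k) a x) ('D_(E k) b x) ('D_(E k) a x).

Let derive_tensor_y x y i j m : U x -> y != 0 ->
  'D_(E m) (fun y' => fundamental_tensor L x y' i j) y = dGy x y (E m) i j.
Proof.
move=> Ux y0.
have E1 : \forall w \near y, fundamental_tensor L x w i j = G x w i j.
  have : \forall w \near y, w != 0 by exact: near_neq0.
  by apply: filterS => w; exact: fundamental_tensor_randers.
have qn0 : q x y != 0 by rewrite gt_eqF// qgt0.
have h : is_derive y (E m) (fun w => G x w i j) (dGy x y (E m) i j).
  move: i j {E1}; apply/is_derive_mxP.
  exact: (is_derive_randersG qn0 (is_derive_qy (E m) Ux y0)
  (is_derive_by x y (E m)) (is_derive_Uy x y (E m)) (is_derive_cst (b x) y (E m))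
  (is_derive_cst (a x) y (E m))).
exact: (near_derive_val (g := fun w => G x w i j)) E1 h.
Qed.

Let derive_tensor_x x y i j k : U x -> y != 0 ->
  'D_(E k) (fun x' => fundamental_tensor L x' y i j) x = dGx x y k i j.
Proof.
move=> Ux y0.
have E1 : \forall z \near x, fundamental_tensor L z y i j = G z y i j.
  by apply: open_near oU Ux _ => z Uz; exact: fundamental_tensor_randers.
have qn0 : q x y != 0 by rewrite gt_eqF// qgt0.
have ha := derivableP (@da x (E k) Ux); have hb := derivableP (@db x (E k) Ux).
have hy := is_derive_cst y x (E k).
have hq : is_derive x (E k) (fun z => q z y)
    ((2 * q x y)^-1 * bil ('D_(E k) a x) y y).
  apply: is_derive_sqrt; first exact: a_pos.
  apply: is_derive_eq (is_derive_bil ha hy hy) _.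
  by rewrite bil0l bil0r !addr0.
have hbe : is_derive x (E k) (fun z => dot (b z) y) (dot ('D_(E k) b x) y).
  apply: is_derive_eq (is_derive_dot hb hy) _.
  by rewrite dot0r addr0.
have hU : is_derive x (E k) (fun z => y *m a z) (y *m 'D_(E k) a x).
  by apply: is_derive_eq (is_derive_mulmx hy ha) _; rewrite mul0mx add0r.
have h : is_derive x (E k) (fun z => G z y i j) (dGx x y k i j).
  have H := is_derive_randersG (q := fun z => q z y) qn0 hq hbe hU hb ha.
  by move/is_derive_mxP : H => /(_ i j).
exact: (near_derive_val (g := fun z => G z y i j)) E1 h.
Qed.

Let dGy_linear x y : U x -> y != 0 -> linear (dGy x y).
Proof.
move=> Ux y0 c u v; rewrite /dGy.
have qn0 : q x y != 0 by rewrite gt_eqF// qgt0.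
rewrite -(drandersG_linear _ _ _ _ c)//.
apply: eq_drandersG.
- by rewrite bilDl bilDr bilZl bilZr; ring.
- by rewrite dotC dotDl dotZl ![dot _ (b x)]dotC.
- by rewrite mulmxDl -scalemxAl.
- by rewrite scaler0 addr0.
- by rewrite scaler0 addr0.
Qed.

Let dGy_sum x y (N : 'rV[R]_n) i j : U x -> y != 0 ->
  \sum_m dGy x y (E m) i j * N 0 m = dGy x y N i j.
Proof.
move=> Ux y0.
pose F : {linear 'rV[R]_n -> 'M[R]_n} :=
  HB.pack (dGy x y) (GRing.isLinear.Build _ _ _ _ _ (dGy_linear Ux y0)).
have -> : dGy x y N = F (\sum_m N 0 m *: E m) by rewrite -row_sum_delta.
rewrite linear_sum summxE.
by apply: eq_bigr => m _; rewrite [in RHS]linearZ [RHS]mxE [RHS]mulrC.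
Qed.

Let defect x y T tau := drandersG (q x y) (dot (b x) y) (y *m a x) (b x) (a x)
  (bil T y y / (2 * q x y)) (dot tau y) (y *m T) tau T.

(** The direction of differentiation in x splits into moving y along y K, acting
    on (y a, b, a) by the linear change of coordinates generated by K, and the
    rest, which is the action of (T, tau).  The first two are the terms of the
    Chern equation. *)
Lemma chern_defect x y (K : 'M[R]_n) k : U x -> y != 0 ->
  let T := 'D_(E k) a x - (K *m a x + a x *m K^T) in
  let tau := 'D_(E k) b x - b x *m K^T in
  dGx x y k = dGy x y (y *m K) + (K *m G x y + G x y *m K^T)
    + defect x y T tau.
Proof.
move=> Ux y0 T tau; rewrite /defect.
have qn0 : q x y != 0 by rewrite gt_eqF// qgt0.
have gl := drandersG_gl (q x y) (dot (b x) y) (y *m a x) (b x) (a x) K^T.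
rewrite trmxK -/(G x y) in gl.
rewrite -gl -!drandersGD// /dGx /T /tau.
move: ('D_(E k) a x) ('D_(E k) b x) => A B; apply: eq_drandersG.
- have -> : bil (a x) (y *m K) y = bil (K *m a x) y y by rewrite /bil !mulmxA.
  have -> : bil (a x) y (y *m K) = bil (a x *m K^T) y y.
    by rewrite /bil trmx_mul !mulmxA.
  by rewrite bilDm bilNm bilDm; field.
- have -> : dot (b x) (y *m K) = dot (b x *m K^T) y.
    by rewrite /dot trmx_mul !mulmxA.
  by rewrite dotDl dotNl; ring.
- by rewrite mulmxBr mulmxDr !mulmxA addrC subrK.
- by rewrite add0r addrC subrK.
- by rewrite add0r addrC subrK.
Qed.

Lemma bil_chern_defect x y T tau : U x -> y != 0 ->
  bil (defect x y T tau) y y = L x y * (2 * dot tau y + bil T y y / q x y).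
Proof.
move=> Ux y0; apply: bil_drandersG => //.
- by rewrite gt_eqF// qgt0.
- by rewrite qsq.
- by rewrite qsq.
Qed.

(** Torsion-free coefficients at x preserving both the metric a and the
    covector b. *)
Definition parallel_coeff x (Gam : 'I_n -> 'I_n -> 'I_n -> R) :=
  (forall m j k, Gam m j k = Gam m k j) /\
  forall k, 'D_(E k) a x = conn_mx Gam k *m a x + a x *m (conn_mx Gam k)^T /\
            'D_(E k) b x = b x *m (conn_mx Gam k)^T.

Let chern_eqE x y k Gam : U x -> y != 0 ->
  (forall i j, 'D_(E k) (fun x' => fundamental_tensor L x' y i j) x
      - \sum_(m < n) fundamental_tensor L x y m j * Gam m i k
      - \sum_(m < n) fundamental_tensor L x y i m * Gam m j k
      = \sum_(m < n) 'D_(E m) (fun y' => fundamental_tensor L x y' i j) y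
                     * \sum_(l < n) y 0 l * Gam m l k) <->
  let K := conn_mx Gam k in
  let T := 'D_(E k) a x - (K *m a x + a x *m K^T) in
  let tau := 'D_(E k) b x - b x *m K^T in
  defect x y T tau = 0.
Proof.
move=> Ux y0; cbv zeta; set K := conn_mx Gam k.
have := chern_defect K k Ux y0; cbv zeta.
set D := defect _ _ _ _ => E0.
have S1 i j : \sum_(m < n) fundamental_tensor L x y m j * Gam m i k = (K *m G x y) i j.
  rewrite [RHS]mxE; apply: eq_bigr => m _.
  by rewrite fundamental_tensor_randers// mulrC [K _ _]mxE.
have S2 i j : \sum_(m < n) fundamental_tensor L x y i m * Gam m j k = (G x y *m K^T) i j.
  rewrite [RHS]mxE; apply: eq_bigr => m _.
  by rewrite fundamental_tensor_randers// [K^T _ _]mxE [K _ _]mxE.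
have S3 i j : \sum_(m < n) 'D_(E m) (fun y' => fundamental_tensor L x y' i j) y
                     * \sum_(l < n) y 0 l * Gam m l k = dGy x y (y *m K) i j.
  rewrite -(dGy_sum _ _ _ Ux y0); apply: eq_bigr => m _.
  rewrite derive_tensor_y//; congr (_ * _).
  by rewrite [RHS]mxE; apply: eq_bigr => l _; rewrite [K _ _]mxE.
have ent (A B C D' F : 'M[R]_n) i j : A = B + (C + D') + F ->
    (A i j - C i j - D' i j = B i j <-> F i j = 0).
  by move=> ->; rewrite !mxE; split=> h; lra.
split=> [H|D0 i j].
  apply/matrixP => i j; rewrite [RHS]mxE.
  by apply/(ent _ _ _ _ _ i j E0); rewrite -S1 -S2 -S3 -H derive_tensor_x.
rewrite S1 S2 S3 derive_tensor_x//; apply/(ent _ _ _ _ _ i j E0).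
by rewrite D0 mxE.
Qed.

(** From left to right, [chern_defect] contracted with y leaves an even and an
    odd function of y, since T and tau do not depend on y; both vanish. *)
Theorem berwald_local_iff : (0 < n)%N ->
  (exists Gam : 'rV[R]_n -> 'rV[R]_n -> 'I_n -> 'I_n -> 'I_n -> R,
      chern_connection L U Gam /\
      forall x y y', U x -> y != 0 -> y' != 0 -> Gam x y = Gam x y') <->
  forall x, U x -> exists Gam, parallel_coeff x Gam.
Proof.
move=> n0; pose y1 : 'rV[R]_n := E (Ordinal n0).
have y10 : y1 != 0 by exact: basis_vec_neq0.
split=> [[Gam [chern ind]] x Ux|H].
  exists (Gam x y1); split=> [|k].
    by have [] := chern x y1 Ux y10.
  set K := conn_mx (Gam x y1) k.
  pose T := 'D_(E k) a x - (K *m a x + a x *m K^T).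
  pose tau := 'D_(E k) b x - b x *m K^T.
  have key y : y != 0 -> 2 * dot tau y + bil T y y / q x y = 0.
    move=> y0; have [_ c] := chern x y Ux y0; rewrite (ind x y y1)// in c.
    have /chern_eqE := fun i j => c i j k.
    move=> /(_ Ux y0) h.
    have := bil_chern_defect T tau Ux y0.
    rewrite [X in bil X _ _]h /bil mulmx0 mul0mx mxE => /esym/eqP.
    by rewrite mulf_eq0 (negbTE (L_neq0 Ux y0)) => /eqP.
  have qN y : q x (- y) = q x y by rewrite /q bilNl bilNr opprK.
  (* The first term in [key] is odd in y, the second one even. *)
  have both y : y != 0 -> dot tau y = 0 /\ bil T y y = 0.
    move=> y0; have k1 := key y y0.
    have := key (- y); rewrite oppr_eq0 => /(_ y0).
    rewrite qN dotNr bilNl bilNr opprK => k2.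
    have [k3 k4] : dot tau y = 0 /\ bil T y y / q x y = 0 by split; lra.
    split=> //.
    by rewrite -[LHS](divfK (negbT (gt_eqF (qgt0 Ux y0)))) k4 mul0r.
  have tau0 : tau = 0.
    apply/rowP => i; rewrite [RHS]mxE -dot_delta.
    by have [] := both _ (basis_vec_neq0 i).
  have aS : ('D_(E k) a x)^T = 'D_(E k) a x.
    have [_ <-] := is_derive_trmx (derivableP (@da x (E k) Ux)).
    by apply: near_eq_derive; apply: open_near oU Ux a_sym.
  have T0 : T = 0.
    apply: sym_bil0 => [|y /both[]//].
    rewrite /T linearB linearD /= aS !trmx_mul trmxK (a_sym Ux).
    by rewrite [a x *m _ + _]addrC.
  by split; apply/subr0_eq.
have {}H x : exists Gam, U x -> parallel_coeff x Gam.
  have [/H[Gam pGam]|nUx] := pselect (U x); first by exists Gam.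
  by exists (fun _ _ _ => 0) => /nUx.
have [Gam0 pGam] := choice H.
exists (fun x _ => Gam0 x); split=> // x y Ux y0.
have [sym par] := pGam x Ux; split=> // i j k.
move: i j; apply/(chern_eqE _ _ Ux y0); cbv zeta.
have [-> ->] := par k.
rewrite /defect !subrr bil0m mulmx0 dot0l mul0r.
exact: drandersG0.
Qed.

End LocalRanders.

(** * Parallel covectors are closed and Killing *)

Section ParallelAlgebra.
Context {R : realType} {n : nat}.
Context (M : 'M[R]_n) (dM : 'I_n -> 'M[R]_n).
Context (X : 'rV[R]_n) (dX : 'I_n -> 'rV[R]_n).
Context (M_sym : M^T = M).
Context (M_pos : forall y, y != 0 -> 0 < bil M y y).
Context (dM_sym : forall k, (dM k)^T = dM k).

Let dB k := dX k *m M + X *m dM k.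

Lemma posdef_unitmx : M \in unitmx.
Proof.
rewrite -row_free_unit -kermx_eq0; apply/rowV0P => v /sub_kermxP vM.
apply/eqP/negP => /negP /M_pos.
by rewrite /bil vM mul0mx mxE ltxx.
Qed.

(** The only torsion-free connection preserving M is the Levi-Civita connection;
    H below is its Christoffel symbols of the first kind, and M^-1 raises the
    index.  It preserves b = X M iff db = X H^T.  The skew part of this equation
    says that db is symmetric, the symmetric part that the Lie derivative of M
    along X vanishes. *)
Lemma exists_parallel_connection :
  (exists Gam : 'I_n -> 'I_n -> 'I_n -> R,
    (forall m j k, Gam m j k = Gam m k j) /\
    forall k, dM k = conn_mx Gam k *m M + M *m (conn_mx Gam k)^T /\
              dB k = X *m M *m (conn_mx Gam k)^T) <->
  (forall i k, dB k 0 i = dB i 0 k) /\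
  (forall i k, (\sum_l X 0 l *: dM l) i k + (dX i *m M) 0 k + (dX k *m M) 0 i = 0).
Proof.
split=> [[Gam [sym par]]|[C K]].
  have dXM k : dX k *m M = - (X *m conn_mx Gam k *m M).
    have [e1 e2] := par k; apply/eqP; rewrite -addr_eq0; apply/eqP.
    move/eqP: e2; rewrite /dB e1 mulmxDr !mulmxA addrA -subr_eq0 addrK.
    by move/eqP.
  have XG i m : (\sum_l X 0 l *: conn_mx Gam l) i m = (X *m conn_mx Gam i) 0 m.
    by rewrite summxE mxE; apply: eq_bigr => l _; rewrite !mxE sym.
  split=> i k.
    have [_ ->] := par k; have [_ ->] := par i.
    by rewrite !mxE; apply: eq_bigr => m _; rewrite !mxE sym.
  have -> : \sum_l X 0 l *: dM l = (\sum_l X 0 l *: conn_mx Gam l) *m M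
      + ((\sum_l X 0 l *: conn_mx Gam l) *m M)^T.
    rewrite mulmx_suml linear_sum -big_split; apply: eq_bigr => l _ /=.
    have [-> _] := par l.
    by rewrite scalerDr trmx_mul M_sym linearZ -scalemxAl -scalemxAr.
  have XGM j m : ((\sum_l X 0 l *: conn_mx Gam l) *m M) j m
      = (X *m conn_mx Gam j *m M) 0 m.
    by rewrite mxE [RHS]mxE; apply: eq_bigr => p _; rewrite XG.
  rewrite mxE [_^T i k]mxE !XGM !dXM [(- _ : 'rV__) 0 k]mxE [(- _ : 'rV__) 0 i]mxE.
  lra.
pose H k : 'M[R]_n := \matrix_(i, j) (2^-1 * (dM i j k + dM k j i - dM j i k)).
pose Gam m i k := (H k *m invmx M) i m.
have GE k : conn_mx Gam k = H k *m invmx M by apply/matrixP => i m; rewrite mxE.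
have dMs k i j : dM k i j = dM k j i by rewrite -[in LHS]dM_sym mxE.
have GM k : conn_mx Gam k *m M = H k by rewrite GE mulmxKV// posdef_unitmx.
have MG k : M *m (conn_mx Gam k)^T = (H k)^T by rewrite -GM trmx_mul M_sym.
exists Gam; split=> [m j k|k].
  rewrite /Gam !mxE; apply: eq_bigr => p _; rewrite !mxE.
  by rewrite (dMs p k j) [dM j p k + _]addrC.
rewrite -mulmxA GM MG; split.
  by apply/matrixP => i j; rewrite !mxE (dMs k j i); field.
apply/rowP => i.
have -> : (X *m (H k)^T) 0 i
   = 2^-1 * ((X *m dM i) 0 k + (X *m dM k) 0 i - (\sum_l X 0 l *: dM l) i k).
  rewrite summxE !mxE -big_split -sumrB mulr_sumr; apply: eq_bigr => l _.
  by rewrite !mxE /=; ring.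
have dBE p r : dB p 0 r = (dX p *m M) 0 r + (X *m dM p) 0 r by rewrite [LHS]mxE.
by have := K i k; have := C i k; rewrite !dBE; lra.
Qed.

End ParallelAlgebra.

(** * Lie groups in charts *)

Section Charts.
Context {R : realType} {n : nat} {G : TopGroup.type}.
Context (A : smooth_atlas R n G) (hG : lie_group A).

Lemma chart_img_map (i : chart A) p : chart_dom i p -> chart_img i (chart_map i p).
Proof. by move=> ip; exists p. Qed.

Lemma chart_inv_dom (i : chart A) z : chart_img i z -> chart_dom i (chart_inv i z).
Proof. by move=> [p ip <-]; rewrite chart_mapK. Qed.

Lemma chart_invK (i : chart A) z : chart_img i z -> chart_map i (chart_inv i z) = z.
Proof. by move=> [p ip <-]; rewrite chart_mapK. Qed.

(** For a = 1 this is the transition map from the chart j to the chart k, so that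
    one set of lemmas serves for translations and for changes of charts. *)
Definition ltrans (a : G) (j k : chart A) (w : 'rV[R]_n) : 'rV[R]_n :=
  chart_map k (a * chart_inv j w)%g.

Definition ltrans_dom (a : G) (j k : chart A) : set 'rV[R]_n :=
  [set w | chart_img j w /\ chart_dom k (a * chart_inv j w)%g].

Definition dltrans (a : G) (j k : chart A) (p : G) (u : 'rV[R]_n) : 'rV[R]_n :=
  'd (ltrans a j k) (chart_map j p) u.

Lemma ltrans_dom_map a j k p : chart_dom j p -> chart_dom k (a * p)%g ->
  ltrans_dom a j k (chart_map j p).
Proof. by move=> jp kap; split; [exact: chart_img_map|rewrite chart_mapK]. Qed.

Lemma ltrans_map a j k p : chart_dom j p ->
  ltrans a j k (chart_map j p) = chart_map k (a * p)%g.
Proof. by move=> jp; rewrite /ltrans chart_mapK. Qed.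

Lemma continuous_lmul (a : G) : continuous (fun q : G => a * q)%g.
Proof.
have [_ _ [cm _] _] := hG.
move=> q; apply: (@continuous_comp _ _ _ (fun q => (a, q)) (fun p : G * G => p.1 * p.2)%g).
  by apply: cvg_pair => //=; exact: cvg_cst.
exact: cm.
Qed.

Lemma open_ltrans_dom a j k : open (ltrans_dom a j k).
Proof.
rewrite openE => w [jw kaw]; rewrite /interior /=.
apply: filterI; first by apply: open_nbhs_nbhs; split=> //; exact: chart_img_open.
have cinv : {for w, continuous (chart_inv j)}.
  by have [p jp <-] := jw; exact: chart_inv_continuous.
have c : {for w, continuous (fun w => a * chart_inv j w)%g}.
  by apply: continuous_comp cinv _; exact: continuous_lmul.
apply: c; apply: open_nbhs_nbhs; split=> //; exact: chart_dom_open.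
Qed.

(** A partial map of the multiplication in charts. *)
Lemma smooth_ltrans a j k : smooth_on (ltrans_dom a j k) (ltrans a j k).
Proof.
have [_ _ [_ sm] _] := hG => m.
have := Ck_on_sliceR (chart_map (chart_at A a) a) (sm (chart_at A a) j k m).
have Ea : chart_inv (chart_at A a) (chart_map (chart_at A a) a) = a.
  by rewrite chart_mapK//; exact: chart_at_dom.
rewrite /= Ea; apply: Ck_onS => w [jw kaw] /=; split=> //.
by apply: chart_img_map; exact: chart_at_dom.
Qed.

Lemma differentiable_ltrans a j k w : ltrans_dom a j k w ->
  differentiable (ltrans a j k) w.
Proof. by move=> dw; have [+ _] := smooth_ltrans a j k 1; apply. Qed.

Lemma dltransE a j k p u : chart_dom j p -> chart_dom k (a * p)%g ->
  dltrans a j k p u = 'D_u (ltrans a j k) (chart_map j p).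
Proof.
move=> jp kap; rewrite /dltrans deriveE//.
exact/differentiable_ltrans/ltrans_dom_map.
Qed.

Lemma dltrans_comp a b j k l p q u : q = (a * p)%g ->
  chart_dom j p -> chart_dom k q -> chart_dom l (b * q)%g ->
  dltrans b k l q (dltrans a j k p u) = dltrans (b * a)%g j l p u.
Proof.
move=> -> jp kap lbap.
have lbap' : chart_dom l (b * a * p)%g by rewrite -mulgA.
rewrite (dltransE _ kap lbap) (dltransE _ jp kap) (dltransE _ jp lbap').
have da := differentiable_ltrans (ltrans_dom_map jp kap).
have db := differentiable_ltrans (ltrans_dom_map kap lbap).
rewrite -(ltrans_map _ _ jp) in db *.
apply: etrans (esym (derive_comp u da db)) _; apply: near_eq_derive.
apply: open_near (@open_ltrans_dom a j k) (ltrans_dom_map jp kap) _ => w [jw kw] /=.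
by rewrite /ltrans /= chart_mapK// mulgA.
Qed.

Lemma dltrans1 i p u : chart_dom i p -> dltrans 1%g i i p u = u.
Proof.
move=> ip; rewrite dltransE ?mul1g//.
have E1 : \forall w \near chart_map i p, ltrans 1%g i i w = id w.
  apply: open_near (@chart_img_open _ _ _ A i) (chart_img_map ip) _ => w iw.
  by rewrite /ltrans mul1g chart_invK.
by rewrite (near_eq_derive _ E1) derive_id.
Qed.

Lemma tcoordE (i : chart A) p u : tcoord i p u = dltrans 1%g (chart_at A p) i p u.
Proof.
rewrite /tcoord /dltrans; suff -> : chart_map i \o chart_inv (chart_at A p)
  = ltrans 1%g (chart_at A p) i by [].
by apply/funext => w; rewrite /ltrans mul1g.
Qed.

Lemma tvecE (i : chart A) p u : tvec i p u = dltrans 1%g i (chart_at A p) p u.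
Proof.
rewrite /tvec /dltrans; suff -> : chart_map (chart_at A p) \o chart_inv i
  = ltrans 1%g i (chart_at A p) by [].
by apply/funext => w; rewrite /ltrans mul1g.
Qed.

Lemma tcoord_tvec (i : chart A) p u : chart_dom i p -> tcoord i p (tvec i p u) = u.
Proof.
move=> ip; rewrite tcoordE tvecE (dltrans_comp (a := 1%g)) ?mul1g ?dltrans1//.
exact: chart_at_dom.
Qed.

Lemma tvec_tcoord (i : chart A) p u : chart_dom i p -> tvec i p (tcoord i p u) = u.
Proof.
move=> ip; rewrite tcoordE tvecE (dltrans_comp (a := 1%g)) ?mul1g ?dltrans1//;
  exact: chart_at_dom.
Qed.

Lemma tangent_ltransE a p u : tangent_map A (fun q => a * q)%g p u
  = dltrans a (chart_at A p) (chart_at A (a * p)%g) p u.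
Proof. by []. Qed.

Lemma left_invariant_at1 (Y : vfield A) p : left_invariant Y ->
  Y p = dltrans p (chart_at A 1%g) (chart_at A p) 1%g (Y 1%g).
Proof. by move=> hY; have := hY p 1%g; rewrite tangent_ltransE mulg1. Qed.

Lemma vf_coord_map i (Y : vfield A) p : chart_dom i p ->
  vf_coord i Y (chart_map i p) = tcoord i p (Y p).
Proof. by move=> ip; rewrite /vf_coord chart_mapK. Qed.

Lemma vf_coord_at1 i (Y : vfield A) p : left_invariant Y -> chart_dom i p ->
  vf_coord i Y (chart_map i p) = dltrans p (chart_at A 1%g) i 1%g (Y 1%g).
Proof.
move=> hY ip; rewrite vf_coord_map// tcoordE left_invariant_at1//.
by rewrite (dltrans_comp (a := p)) ?mulg1 ?mul1g//; exact: chart_at_dom.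
Qed.

Lemma vf_coord_ltrans a j k (Y : vfield A) p : left_invariant Y ->
  chart_dom j p -> chart_dom k (a * p)%g ->
  vf_coord k Y (chart_map k (a * p)%g) = dltrans a j k p (vf_coord j Y (chart_map j p)).
Proof.
move=> hY jp kap; rewrite !vf_coord_at1//.
by rewrite (dltrans_comp (a := p)) ?mulg1//; exact: chart_at_dom.
Qed.

(** The coordinates of Y at p are the derivative of the product at (p, 1) in
    the direction (0, Y 1), so they depend smoothly on p. *)
Lemma left_invariant_smooth (Y : vfield A) : left_invariant Y -> smooth_vf Y.
Proof.
move=> hY i m; pose j := chart_at A 1%g; pose z1 := chart_map j 1%g.
have Ej : chart_inv j z1 = 1%g by rewrite chart_mapK//; exact: chart_at_dom.
have [_ _ [_ sm] _] := hG.
have [_ /(_ (0, Y 1%g)) D] := sm i j i m.+1.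
have {}D := Ck_on_sliceL z1 D.
have {D} := @Ck_onS _ _ _ m _ (chart_img i) _ _ D.
have sub : chart_img i `<=` [set x | [set z : 'rV[R]_n * 'rV[R]_n |
    [/\ chart_img i z.1, chart_img j z.2 &
        chart_dom i (chart_inv i z.1 * chart_inv j z.2)%g]] (x, z1)].
  move=> z iz; split=> //=; first by apply: chart_img_map; exact: chart_at_dom.
  by rewrite Ej mulg1; exact: chart_inv_dom.
move=> /(_ sub); apply: Ck_on_eq; first exact: chart_img_open.
move=> _ [p ip <-].
have E : (fun w => chart_map i (chart_inv i (chart_map i p) * chart_inv j w)%g)
    = ltrans p j i by apply/funext => w; rewrite /ltrans chart_mapK.
apply: etrans (esym (derive_sliceR _ _ _ _)) _; rewrite /= E (vf_coord_at1 hY ip).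
by rewrite dltransE ?mulg1//; exact: chart_at_dom.
Qed.

Lemma lie_algebraP (Y : vfield A) : lie_algebra Y <-> left_invariant Y.
Proof. by split=> [[]//|hY]; split=> //; exact: left_invariant_smooth. Qed.

Definition left_field (v : 'rV[R]_n) : vfield A :=
  fun p => dltrans p (chart_at A 1%g) (chart_at A p) 1%g v.

Lemma left_field_invariant v : left_invariant (left_field v).
Proof.
move=> a p; rewrite tangent_ltransE /left_field.
by rewrite (dltrans_comp (a := p)) ?mulg1//; exact: chart_at_dom.
Qed.

Lemma left_field1 v : left_field v 1%g = v.
Proof. by rewrite /left_field dltrans1//; exact: chart_at_dom. Qed.

Lemma left_invariant_inj (Y Z : vfield A) : left_invariant Y -> left_invariant Z ->
  Y 1%g = Z 1%g -> Y = Z.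
Proof.
move=> hY hZ E; apply/funext => p.
by rewrite (left_invariant_at1 p hY) (left_invariant_at1 p hZ) E.
Qed.

Lemma left_invariant_lin c (Y Z : vfield A) : left_invariant Y -> left_invariant Z ->
  left_invariant (c *: Y + Z : vfield A).
Proof.
move=> hY hZ a p; rewrite -[RHS]/(c *: Y (a * p)%g + Z (a * p)%g) -hY -hZ.
by rewrite /tangent_map -linearP.
Qed.

(** Left-invariant fields span each tangent space: transport the vector back to
    the identity. *)
Lemma left_field_at i p (v : 'rV[R]_n) : chart_dom i p ->
  exists2 Y : vfield A, left_invariant Y & vf_coord i Y (chart_map i p) = v.
Proof.
move=> ip; exists (left_field (dltrans p^-1%g i (chart_at A 1%g) p v)).
  exact: left_field_invariant.
rewrite vf_coord_at1//; last exact: left_field_invariant.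
rewrite left_field1 (dltrans_comp (a := p^-1%g)) ?mulVg ?mulgV ?dltrans1 ?mulg1//.
exact: chart_at_dom.
Qed.

Definition coord_bracket i (Y Z : vfield A) (z : 'rV[R]_n) : 'rV[R]_n :=
  'D_(vf_coord i Y z) (vf_coord i Z) z - 'D_(vf_coord i Z z) (vf_coord i Y) z.

Lemma vf_coord_chart_at (Y : vfield A) p :
  vf_coord (chart_at A p) Y (chart_map (chart_at A p) p) = Y p.
Proof.
by rewrite vf_coord_map ?tcoordE ?dltrans1//; exact: chart_at_dom.
Qed.

Lemma bracket_chart_at (Y Z : vfield A) p : bracket Y Z p
  = coord_bracket (chart_at A p) Y Z (chart_map (chart_at A p) p).
Proof. by rewrite /coord_bracket !vf_coord_chart_at. Qed.

Lemma differentiable_vf_coord i (Y : vfield A) z : left_invariant Y -> chart_img i z ->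
  differentiable (vf_coord i Y) z.
Proof. by move=> /left_invariant_smooth /(_ i 1%N) [+ _]; apply. Qed.

(** Left-invariant fields are related to themselves by left translations, to
    which naturality of the bracket applies; a = 1 shows that the bracket does not
    depend on the chart. *)
Lemma coord_bracket_ltrans a j k (Y Z : vfield A) p :
  left_invariant Y -> left_invariant Z ->
  chart_dom j p -> chart_dom k (a * p)%g ->
  coord_bracket k Y Z (chart_map k (a * p)%g)
  = dltrans a j k p (coord_bracket j Y Z (chart_map j p)).
Proof.
move=> hY hZ jp kap; rewrite dltransE// /coord_bracket -(ltrans_map a k jp).
have push (W : vfield A) : left_invariant W -> forall w, ltrans_dom a j k w ->
    vf_coord k W (ltrans a j k w) = 'D_(vf_coord j W w) (ltrans a j k) w.
  move=> hW _ [[q jq <-]]; rewrite chart_mapK// => kaq.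
  by rewrite ltrans_map// (vf_coord_ltrans hW jq kaq) dltransE.
have dk (W : vfield A) : left_invariant W ->
    differentiable (vf_coord k W) (ltrans a j k (chart_map j p)).
  move=> hW; rewrite ltrans_map//.
  by apply: differentiable_vf_coord => //; exact: chart_img_map.
have dj (W : vfield A) : left_invariant W ->
    differentiable (vf_coord j W) (chart_map j p).
  by move=> hW; apply: differentiable_vf_coord => //; exact: chart_img_map.
exact: (derive_pushforward (@open_ltrans_dom a j k) (ltrans_dom_map jp kap)
  (smooth_ltrans a j k 2) (push Y hY) (push Z hZ) (dj Y hY) (dj Z hZ) (dk Y hY) (dk Z hZ)).
Qed.

Lemma bracket_left_invariant (Y Z : vfield A) :
  left_invariant Y -> left_invariant Z -> left_invariant (bracket Y Z).
Proof.
move=> hY hZ a p; rewrite tangent_ltransE !bracket_chart_at.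
by rewrite -coord_bracket_ltrans//; exact: chart_at_dom.
Qed.

Lemma vf_coord_bracket i (Y Z : vfield A) p :
  left_invariant Y -> left_invariant Z -> chart_dom i p ->
  vf_coord i (bracket Y Z) (chart_map i p) = coord_bracket i Y Z (chart_map i p).
Proof.
move=> hY hZ ip; rewrite vf_coord_map// tcoordE bracket_chart_at.
by rewrite -coord_bracket_ltrans ?mul1g//; exact: chart_at_dom.
Qed.

End Charts.

(** * Left-invariant metrics in charts *)

Section Metric.
Context {R : realType} {n : nat} {G : TopGroup.type}.
Context (A : smooth_atlas R n G) (hG : lie_group A).
Context (g : tensor2 A) (hg : riemannian_metric g).
Context (hginv : left_invariant_metric g).

(** The matrix of [tvec], which turns components of tensors into products of
    matrices. *)
Definition tvec_mx (i : chart A) (z : 'rV[R]_n) : 'M[R]_n :=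
  lin1_mx ('d (chart_map (chart_at A (chart_inv i z)) \o chart_inv i)
              (chart_map i (chart_inv i z))).

Definition gram i z : 'M[R]_n :=
  tvec_mx i z *m g (chart_inv i z) *m (tvec_mx i z)^T.

Lemma tvec_mxE i z u : tvec i (chart_inv i z) u = u *m tvec_mx i z.
Proof. by rewrite mul_rV_lin1. Qed.

Lemma bil_gram i z u v : bil (gram i z) u v
  = metric_at g (chart_inv i z) (tvec i (chart_inv i z) u) (tvec i (chart_inv i z) v).
Proof. by rewrite !tvec_mxE /metric_at /bil /gram trmx_mul !mulmxA. Qed.

Lemma gram_sym i z : (gram i z)^T = gram i z.
Proof.
have [gs _ _] := hg; apply/matrixP => a b.
by rewrite mxE -!bil_delta !bil_gram gs.
Qed.

Lemma gram_pos i z u : chart_img i z -> u != 0 -> 0 < bil (gram i z) u u.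
Proof.
move=> iz u0; have [_ gp _] := hg; rewrite bil_gram; apply: gp.
apply: contra_neq u0 => tu0.
have := tcoord_tvec hG u (chart_inv_dom iz); rewrite tu0 => <-.
by rewrite /tcoord linear0.
Qed.

Lemma differentiable_gram i z a b : chart_img i z ->
  differentiable (fun w => gram i w a b : R) z.
Proof.
move=> iz; have [_ _ /(_ i a b 1%N) [+ _]] := hg => /(_ z iz).
rewrite (_ : (fun z => metric_at _ _ _ _) = fun w => gram i w a b)//.
by apply/funext => w; rewrite -bil_gram bil_delta.
Qed.

Lemma derivable_gram i z v : chart_img i z -> derivable (gram i) z v.
Proof.
move=> iz; apply/derivable_mxP => a b.
by apply: diff_derivable; exact: differentiable_gram.
Qed.

Arguments derivable_gram {i z} v _.

Lemma derive_gram_coord i z v a b : chart_img i z ->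
  'D_v (gram i) z a b = 'D_v (fun w => gram i w a b : R) z.
Proof.
by move=> iz; have /is_derive_mxP/(_ a b)[_ <-] := derivableP (derivable_gram v iz).
Qed.

Lemma derive_gram_linear i z : chart_img i z -> linear (fun v => 'D_v (gram i) z).
Proof.
move=> iz c u v; apply/matrixP => a b.
have dir := derive_linear_dir (differentiable_gram a b iz) c u v.
apply: etrans (derive_gram_coord _ a b iz) (etrans dir _).
by rewrite -!derive_gram_coord// [RHS]mxE [X in _ = X + _]mxE.
Qed.

Lemma derive_gram_dir i z v : chart_img i z ->
  'D_v (gram i) z = \sum_c v 0 c *: 'D_(basis_vec R c) (gram i) z.
Proof.
move=> iz; apply/matrixP => a b; rewrite summxE.
apply: etrans (derive_gram_coord _ a b iz) _.
rewrite (derive_row_dir v (differentiable_gram a b iz)).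
by apply: eq_bigr => c _; rewrite [RHS]mxE derive_gram_coord.
Qed.

Lemma metric_coord i p (Y Z : vfield A) : chart_dom i p ->
  bil (gram i (chart_map i p)) (vf_coord i Y (chart_map i p))
    (vf_coord i Z (chart_map i p)) = metric_at g p (Y p) (Z p).
Proof.
by move=> ip; rewrite bil_gram !vf_coord_map// chart_mapK// !(tvec_tcoord hG).
Qed.

Lemma metric_const (Y Z : vfield A) p : left_invariant Y -> left_invariant Z ->
  metric_at g p (Y p) (Z p) = ip g Y Z.
Proof.
move=> hY hZ; have := hginv p 1%g (Y 1%g) (Z 1%g).
by rewrite hY hZ mulg1.
Qed.

(** g(Y, Z) is constant for left-invariant Y and Z. *)
Lemma derive_metric i z v (Y Z : vfield A) : left_invariant Y -> left_invariant Z ->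
  chart_img i z ->
  bil ('D_v (gram i) z) (vf_coord i Y z) (vf_coord i Z z)
  + bil (gram i z) ('D_v (vf_coord i Y) z) (vf_coord i Z z)
  + bil (gram i z) (vf_coord i Y z) ('D_v (vf_coord i Z) z) = 0.
Proof.
move=> hY hZ iz.
have dY := is_derive_diff v (differentiable_vf_coord hG hY iz).
have dZ := is_derive_diff v (differentiable_vf_coord hG hZ iz).
have h := is_derive_bil (derivableP (derivable_gram v iz)) dY dZ.
have c : \forall w \near z,
    bil (gram i w) (vf_coord i Y w) (vf_coord i Z w) = cst (ip g Y Z) w.
  apply: open_near (@chart_img_open _ _ _ A i) iz _ => _ [p ip <-] /=.
  by rewrite metric_coord// metric_const.
have [_ e] := h.
exact: (etrans (esym e) (near_derive_val c (is_derive_cst _ z v))).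
Qed.

Section Field.
Context (X : vfield A) (hX : left_invariant X).

(** The components of the 1-form g(X, -).  This formula agrees with them at
    all z, inside the image of the chart or not, which makes the local Finsler
    function an expression in it everywhere. *)
Definition covector i z : 'rV[R]_n :=
  X (chart_inv i z) *m g (chart_inv i z) *m (tvec_mx i z)^T.

Lemma covectorE i z u : dot (covector i z) u
  = flat g X (chart_inv i z) (tvec i (chart_inv i z) u).
Proof. by rewrite tvec_mxE /flat /metric_at /dot /covector trmx_mul !mulmxA. Qed.

Lemma covector_gram i z : chart_img i z -> covector i z = vf_coord i X z *m gram i z.
Proof.
move=> [p ip <-]; rewrite /covector /gram !mulmxA -tvec_mxE vf_coord_map// chart_mapK//.
by rewrite (tvec_tcoord hG).
Qed.

Lemma is_derive_covector i z v : chart_img i z ->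
  is_derive z v (covector i) ('D_v (vf_coord i X) z *m gram i z
    + vf_coord i X z *m 'D_v (gram i) z).
Proof.
move=> iz; apply: near_eq_is_derive (is_derive_mulmx
  (is_derive_diff v (differentiable_vf_coord hG hX iz)) (derivableP (derivable_gram v iz))).
apply: open_near (@chart_img_open _ _ _ A i) iz _ => w iw.
by rewrite covector_gram.
Qed.

Arguments is_derive_covector {i z} v _.

Lemma derive_covector_linear i z : chart_img i z -> linear (fun v => 'D_v (covector i) z).
Proof.
move=> iz c u v.
have [_ ->] := is_derive_covector (c *: u + v) iz.
have [_ ->] := is_derive_covector u iz.
have [_ ->] := is_derive_covector v iz.
rewrite (derive_gram_linear iz) (derive_linear_dir (differentiable_vf_coord hG hX iz)).
move: ('D_u (vf_coord i X) z) ('D_v (vf_coord i X) z).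
move: ('D_u (gram i) z) ('D_v (gram i) z) => M1 M2 x1 x2.
by rewrite mulmxDl mulmxDr -scalemxAl -scalemxAr scalerDr addrACA.
Qed.

(** d beta, with beta = g(X, -). *)
Definition exterior i z (v w : 'rV[R]_n) : R :=
  dot ('D_v (covector i) z) w - dot ('D_w (covector i) z) v.

(** The formula d beta (Y, Z) = Y beta(Z) - Z beta(Y) - beta([Y, Z]), where the
    first two terms vanish. *)
Lemma exterior_bracket i p (Y Z : vfield A) : left_invariant Y -> left_invariant Z ->
  chart_dom i p ->
  exterior i (chart_map i p) (vf_coord i Y (chart_map i p)) (vf_coord i Z (chart_map i p))
  = - ip g X (bracket Y Z).
Proof.
move=> hY hZ dp; set z := chart_map i p.
have iz : chart_img i z by exact: chart_img_map.
have half v W : left_invariant W -> dot ('D_v (covector i) z) (vf_coord i W z)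
    = - bil (gram i z) (vf_coord i X z) ('D_v (vf_coord i W) z).
  move=> hW; have [_ ->] := is_derive_covector v iz.
  by rewrite dotDl -!bilE; have := derive_metric v hX hW iz; lra.
have e : ip g X (bracket Y Z) = bil (gram i z) (vf_coord i X z) (coord_bracket i Y Z z).
  apply: etrans (esym (metric_const p hX (bracket_left_invariant hG hY hZ))) _.
  apply: etrans (esym (metric_coord X (bracket Y Z) dp)) _.
  by rewrite (vf_coord_bracket hG hY hZ dp).
have sub_opp (a b c d : R) : a = - c -> b = - d -> a - b = - (c - d).
  by move=> -> ->; rewrite opprB opprK addrC.
rewrite e /coord_bracket bilDr bilNr.
exact: (sub_opp _ _ _ _ (half (vf_coord i Y z) Z hZ) (half (vf_coord i Z z) Y hY)).
Qed.

Lemma closed_form_exterior : closed_form A (flat g X) <->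
  forall i z, chart_img i z -> forall a b,
    'D_(basis_vec R a) (covector i) z 0 b = 'D_(basis_vec R b) (covector i) z 0 a.
Proof.
have E i z a b : chart_img i z -> 'D_(basis_vec R a) (fun w => flat g X (chart_inv i w)
    (tvec i (chart_inv i w) (basis_vec R b))) z = 'D_(basis_vec R a) (covector i) z 0 b.
  move=> iz; have [dc _] := is_derive_covector (basis_vec R a) iz.
  have /is_derive_mxP/(_ 0 b)[_ <-] := derivableP dc.
  have -> : (fun w => covector i w 0 b) = (fun w => flat g X (chart_inv i w)
    (tvec i (chart_inv i w) (basis_vec R b))).
    by apply/funext => w; rewrite -covectorE dot_delta.
  by [].
by split=> H i z iz a b; have := H i z iz a b; rewrite /= !E.
Qed.

(** A closed form is tested at the identity alone; conversely, any two basis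
    vectors at any point are values of left-invariant fields. *)
Lemma closed_form_bracket : closed_form A (flat g X) <->
  forall Y Z : vfield A, left_invariant Y -> left_invariant Z -> ip g X (bracket Y Z) = 0.
Proof.
rewrite closed_form_exterior; split=> [H Y Z hY hZ|H i _ [p ip <-] a b].
  have i1 : chart_dom (chart_at A 1%g) 1%g by exact: chart_at_dom.
  have i1' := chart_img_map i1.
  apply/eqP; rewrite -oppr_eq0 -(exterior_bracket hY hZ i1); apply/eqP.
  exact: (dot_skew_basis (derive_covector_linear i1') (H _ _ i1')).
have [Y hY Ea] := left_field_at hG (basis_vec R a) ip.
have [Z hZ Eb] := left_field_at hG (basis_vec R b) ip.
have := exterior_bracket hY hZ ip; rewrite (H Y Z hY hZ) oppr0 Ea Eb => /subr0_eq e.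
exact: (etrans (esym (dot_delta _ _)) (etrans e (dot_delta _ _))).
Qed.

(** The Lie derivative of the metric along X. *)
Definition killing i z (v w : 'rV[R]_n) : R :=
  bil ('D_(vf_coord i X z) (gram i) z) v w
  + bil (gram i z) ('D_v (vf_coord i X) z) w + bil (gram i z) ('D_w (vf_coord i X) z) v.

(** X g(Y, Z) = 0 together with the Leibniz rule for the Lie derivative. *)
Lemma killing_bracket i p (Y Z : vfield A) : left_invariant Y -> left_invariant Z ->
  chart_dom i p ->
  killing i (chart_map i p) (vf_coord i Y (chart_map i p)) (vf_coord i Z (chart_map i p))
  = - (ip g (bracket X Y) Z + ip g (bracket X Z) Y).
Proof.
move=> hY hZ dp; set z := chart_map i p.
have iz : chart_img i z by exact: chart_img_map.
have e W W' : left_invariant W -> left_invariant W' ->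
    ip g (bracket X W) W' = bil (gram i z) (coord_bracket i X W z) (vf_coord i W' z).
  move=> hW hW'.
  apply: etrans (esym (metric_const p (bracket_left_invariant hG hX hW) hW')) _.
  apply: etrans (esym (metric_coord (bracket X W) W' dp)) _.
  by rewrite (vf_coord_bracket hG hX hW dp).
have alg (M N : 'M[R]_n) (y w xy xw yx wx : 'rV[R]_n) : M^T = M ->
    bil N y w + bil M xy w + bil M y xw = 0 ->
    bil N y w + bil M yx w + bil M wx y = - (bil M (xy - yx) w + bil M (xw - wx) y).
  by move=> sM; rewrite !bilDl !bilNl -[bil M y xw]bil_tr sM; lra.
apply: etrans (alg _ _ _ _ _ _ _ _ (gram_sym i z)
  (derive_metric (vf_coord i X z) hY hZ iz)) _.
by congr (- _); apply/esym/congr2; [exact: (e Y Z hY hZ)|exact: (e Z Y hZ hY)].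
Qed.

Lemma killing_form_bracket :
  (forall i z, chart_img i z -> forall a b,
    killing i z (basis_vec R a) (basis_vec R b) = 0) <->
  forall Y Z : vfield A, left_invariant Y -> left_invariant Z ->
    ip g (bracket X Y) Z + ip g (bracket X Z) Y = 0.
Proof.
split=> [H Y Z hY hZ|H i _ [p ip <-] a b].
  have i1 : chart_dom (chart_at A 1%g) 1%g by exact: chart_at_dom.
  have i1' := chart_img_map i1.
  apply/eqP; rewrite -oppr_eq0 -(killing_bracket hY hZ i1); apply/eqP.
  have dX := differentiable_vf_coord hG hX i1'.
  exact: (bil_sym_basis (derive_linear_dir dX) (H _ _ i1')).
have [Y hY Ea] := left_field_at hG (basis_vec R a) ip.
have [Z hZ Eb] := left_field_at hG (basis_vec R b) ip.
by have := killing_bracket hY hZ ip; rewrite (H Y Z hY hZ) oppr0 Ea Eb.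
Qed.
End Field.
End Metric.

(** * Berwald Randers metrics on a Lie group *)

Section Berwald.
Context {R : realType} {n : nat} {G : TopGroup.type}.
Context (A : smooth_atlas R n G) (hG : lie_group A).
Context (g : tensor2 A) (hg : riemannian_metric g).
Context (hginv : left_invariant_metric g).
Context (X : vfield A) (hX : left_invariant X).
Context (hX1 : forall p : G, Num.sqrt (metric_at g p (X p) (X p)) < 1).

Lemma local_randersE i : local_finsler (randers g X) i
  = fun x y => Num.sqrt (bil (gram g i x) y y) + dot (covector g X i x) y.
Proof.
by apply/funext => x; apply/funext => y; rewrite bil_gram covectorE.
Qed.

(** Cauchy-Schwarz and |X| < 1 bound beta strictly by alpha. *)
Lemma local_randers_gt0 i x y : chart_img i x -> y != 0 ->
  0 < Num.sqrt (bil (gram g i x) y y) + dot (covector g X i x) y.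
Proof.
move=> ix y0; have yy := gram_pos hG hg ix y0.
have [p ip ex] := ix.
have XX : bil (gram g i x) (vf_coord i X x) (vf_coord i X x) < 1.
  rewrite -ex (metric_coord hG)//; have := hX1 p.
  by rewrite -[X in _ < X]sqrtr1 ltr_sqrt.
have CS := cauchy_schwarz (vf_coord i X x) (gram_sym hg i x)
  (fun y => gram_pos hG hg ix) y0.
rewrite bilE -(covector_gram hG)// in CS.
rewrite -ltrBlDr sub0r.
have [d0|d0] := leP 0 (dot (covector g X i x) y).
  by apply: le_lt_trans (_ : 0 < _); [rewrite oppr_le0|rewrite sqrtr_gt0].
rewrite -(ger0_norm (_ : 0 <= - dot (covector g X i x) y)) ?oppr_ge0 ?ltW//.
rewrite -sqrtr_sqr ltr_sqrt// sqrrN; apply: le_lt_trans CS _.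
by rewrite -[ltRHS]mul1r ltr_pM2r.
Qed.

Lemma parallel_at i z : chart_img i z ->
  (exists Gam, parallel_coeff (gram g i) (covector g X i) z Gam) <->
  (forall a b, 'D_(basis_vec R a) (covector g X i) z 0 b
             = 'D_(basis_vec R b) (covector g X i) z 0 a) /\
  (forall a b, killing g X i z (basis_vec R a) (basis_vec R b) = 0).
Proof.
move=> iz.
pose dM k := 'D_(basis_vec R k) (gram g i) z.
pose dX k := 'D_(basis_vec R k) (vf_coord i X) z.
have dMs k : (dM k)^T = dM k.
  apply/matrixP => a b; rewrite mxE !(derive_gram_coord hg _ _ _ iz).
  suff -> : (fun w => gram g i w b a) = (fun w => gram g i w a b) by [].
  by apply/funext => w; rewrite -[in LHS](gram_sym hg) mxE.
have dB k : 'D_(basis_vec R k) (covector g X i) z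
    = dX k *m gram g i z + vf_coord i X z *m dM k.
  by have [_ ->] := is_derive_covector hG hg hX (basis_vec R k) iz.
have := exists_parallel_connection (vf_coord i X z) dX (gram_sym hg i z)
  (fun y => gram_pos hG hg iz) dMs.
have K a b : killing g X i z (basis_vec R a) (basis_vec R b)
  = (\sum_l vf_coord i X z 0 l *: dM l) a b + (dX a *m gram g i z) 0 b
    + (dX b *m gram g i z) 0 a.
  apply: congr2 (congr2 _ _ (dot_delta _ b)) (dot_delta _ a).
  exact: (etrans (congr1 (fun M => bil M _ _)
    (derive_gram_dir hg (vf_coord i X z) iz)) (bil_delta _ a b)).
move=> E; split.
- move=> [Gam [sym par]].
  have [|C KK] := E.1 _.
    exists Gam; split=> // k; have [p1 p2] := par k; split; first exact: p1.
    by rewrite -dB p2 (covector_gram hG).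
  split=> a b; last by rewrite K.
  exact: (etrans (congr1 (fun r : 'rV[R]_n => r 0 b) (dB a))
    (etrans (C b a) (esym (congr1 (fun r : 'rV[R]_n => r 0 a) (dB b))))).
- move=> [C KK]; have [|Gam [sym par]] := E.2 _.
    split=> a b; last by rewrite -K.
    exact: (etrans (esym (congr1 (fun r : 'rV[R]_n => r 0 a) (dB b)))
      (etrans (C b a) (congr1 (fun r : 'rV[R]_n => r 0 b) (dB a)))).
  exists Gam; split=> // k; have [p1 p2] := par k; split; first exact: p1.
  by rewrite dB p2 (covector_gram hG).
Qed.

Theorem berwald_randers_iff : (0 < n)%N ->
  berwald A (randers g X) <->
  (forall Y Z : vfield A, left_invariant Y -> left_invariant Z ->
     ip g X (bracket Y Z) = 0) /\
  (forall Y Z : vfield A, left_invariant Y -> left_invariant Z ->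
     ip g (bracket X Y) Z + ip g (bracket X Z) Y = 0).
Proof.
move=> n0.
rewrite -(closed_form_bracket hG hg hginv hX) -(killing_form_bracket hG hg hginv hX).
rewrite (closed_form_exterior hG hg hX).
have loc i : (exists Gam : 'rV[R]_n -> 'rV[R]_n -> 'I_n -> 'I_n -> 'I_n -> R,
      chern_connection (local_finsler (randers g X) i) (chart_img i) Gam /\
      forall x y y', chart_img i x -> y != 0 -> y' != 0 -> Gam x y = Gam x y') <->
    forall z, chart_img i z ->
      exists Gam, parallel_coeff (gram g i) (covector g X i) z Gam.
  rewrite local_randersE; apply: berwald_local_iff => //.
  - exact: chart_img_open.
  - by move=> x _; exact: gram_sym.
  - by move=> x y; exact: gram_pos.
  - by move=> x v; exact: derivable_gram.
  - by move=> x v ix; have [] := is_derive_covector hG hg hX v ix.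
  - by move=> x y ix y0; rewrite gt_eqF// local_randers_gt0.
split=> [B|[C K] i].
  by split=> i z iz; have /loc/(_ z iz)/(parallel_at iz)[] := B i.
apply/loc => z iz; apply/(parallel_at iz).
by split; [exact: C|exact: K].
Qed.

End Berwald.

(** * Lie algebras with a two-dimensional derived algebra *)

Section LieAlgebra.
Context {R : realType} {n : nat} {G : TopGroup.type}.
Context (A : smooth_atlas R n G) (hG : lie_group A).
Context (g : tensor2 A) (hg : riemannian_metric g).
Implicit Types Y Z W : vfield A.

Lemma ip_sym Y Z : ip g Y Z = ip g Z Y.
Proof. by have [gs _ _] := hg; exact: gs. Qed.

Lemma ipDl Y Z W : ip g (Y + Z) W = ip g Y W + ip g Z W.
Proof. exact: bilDl. Qed.
Lemma ipZl c Y W : ip g (c *: Y) W = c * ip g Y W.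
Proof. exact: bilZl. Qed.
Lemma ipDr Y Z W : ip g W (Y + Z) = ip g W Y + ip g W Z.
Proof. exact: bilDr. Qed.
Lemma ipZr c Y W : ip g W (c *: Y) = c * ip g W Y.
Proof. exact: bilZr. Qed.
Lemma ip0l W : ip g 0 W = 0.
Proof. exact: bil0l. Qed.
Lemma ip0r W : ip g W 0 = 0.
Proof. exact: bil0r. Qed.

Lemma lin_span_mem (V : lmodType R) (S : set V) s : S s -> lin_span S s.
Proof.
move=> Ss; exists 1%N, (fun=> 1), (fun=> s); split=> //.
by rewrite big_ord1 scale1r.
Qed.

Lemma lin_span_orth X (S : set (vfield A)) :
  (forall s, S s -> ip g X s = 0) -> forall W, lin_span S W -> ip g X W = 0.
Proof.
move=> XS _ [m [c [s [Ss ->]]]]; elim/big_ind: _ => [|Y Z XY XZ|k _].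
- exact: ip0r.
- by rewrite ipDr XY XZ addr0.
- by rewrite ipZr XS ?mulr0.
Qed.

Lemma left_invariant0 : left_invariant (0 : vfield A).
Proof. by move=> a p; rewrite /tangent_map linear0. Qed.

Lemma derived_left_invariant W : derived_algebra A W -> left_invariant W.
Proof.
move=> [m [c [s [Ss ->]]]]; elim/big_ind: _ => [|Y Z hY hZ|k _].
- exact: left_invariant0.
- by rewrite -[Y]scale1r; exact: left_invariant_lin.
- rewrite -[_ *: _]addr0; apply: left_invariant_lin; last exact: left_invariant0.
  by have [Y [Z [[_ hY] [_ hZ] ->]]] := Ss k; exact: bracket_left_invariant.
Qed.

Lemma ip_eq0 Y : left_invariant Y -> ip g Y Y = 0 -> Y = 0.
Proof.
move=> hY YY; apply: (left_invariant_inj hY left_invariant0).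
apply/eqP; apply: contraT => Y0; have [_ gp _] := hg.
by have := gp 1%g _ Y0; rewrite [X in _ < X]YY ltxx.
Qed.

Lemma vf_coord_lin i c Y Z : vf_coord i (c *: Y + Z)
  = fun w => c *: vf_coord i Y w + vf_coord i Z w.
Proof. by apply/funext => w; rewrite /vf_coord /tcoord -linearP. Qed.

Lemma bracket_lin X c Y Z : left_invariant X -> left_invariant Y -> left_invariant Z ->
  bracket X (c *: Y + Z) = c *: bracket X Y + bracket X Z.
Proof.
move=> hX hY hZ; apply/funext => p; set i := chart_at A p; set z := chart_map i p.
have iz : chart_img i z by apply: chart_img_map; exact: chart_at_dom.
have d W v : left_invariant W -> is_derive z v (vf_coord i W) ('D_v (vf_coord i W) z).
  by move=> hW; apply: is_derive_diff; exact: differentiable_vf_coord.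
have [_ e1] := is_derive_add (is_derive_scalemx (is_derive_cst c z (X p)) (d Y (X p) hY))
  (d Z (X p) hZ).
have e2 : 'D_((c *: Y + Z) p) (vf_coord i X) z = _ :=
  derive_linear_dir (differentiable_vf_coord hG hX iz) c (Y p) (Z p).
rewrite /bracket -/i -/z vf_coord_lin.
apply: etrans (congr2 (fun u v => u - v) e1 e2) _.
have alg (y a b a' b' : 'rV[R]_n) :
    0 *: y + c *: a + b - (c *: a' + b') = c *: (a - a') + (b - b').
  by rewrite scale0r add0r scalerBr opprD addrACA.
exact: alg.
Qed.

Section Frame.
Context (e1 e2 : vfield A).
Context (he : derived_algebra A = lin_span [set e1; e2]).
Context (he11 : ip g e1 e1 = 1) (he22 : ip g e2 e2 = 1) (he12 : ip g e1 e2 = 0).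

Let P := orth_compl g (derived_algebra A).

Lemma frame1_derived : derived_algebra A e1.
Proof. by rewrite he; apply: lin_span_mem; left. Qed.

Lemma frame2_derived : derived_algebra A e2.
Proof. by rewrite he; apply: lin_span_mem; right. Qed.

Lemma orth_decomposition Y : left_invariant Y ->
  exists2 u, P u & Y = ip g Y e1 *: e1 + (ip g Y e2 *: e2 + u).
Proof.
move=> hY.
have l1 := derived_left_invariant frame1_derived.
have l2 := derived_left_invariant frame2_derived.
exists ((- ip g Y e1) *: e1 + ((- ip g Y e2) *: e2 + Y)).
  split; first by apply/(lie_algebraP hG)/left_invariant_lin => //; exact: left_invariant_lin.
  rewrite he; apply: lin_span_orth => _ [->|->]; rewrite !ipDl !ipZl.
    rewrite he11 [ip g e2 e1]ip_sym he12; lra.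
  rewrite he22 he12; lra.
by rewrite addrA addrACA !scaleNr subrr add0r addrA addrN add0r.
Qed.

Lemma douglas_iff X : lie_algebra X ->
  (forall Y Z, left_invariant Y -> left_invariant Z -> ip g X (bracket Y Z) = 0) <-> P X.
Proof.
move=> hX; split=> [H|[_ H] Y Z hY hZ].
  split=> //; apply: lin_span_orth => _ [Y [Z [[_ hY] [_ hZ] ->]]].
  exact: H.
by apply: H; apply: lin_span_mem; exists Y, Z; split=> //; apply/(lie_algebraP hG).
Qed.

Context (a1 a2 b1 b2 : vfield A) (f1 f2 : vfield A -> vfield A).
Context (hf1 : forall u, P u -> P (f1 u)) (hf2 : forall u, P u -> P (f2 u)).
Context (hue1 : forall u, P u ->
  bracket u e1 = ip g a1 u *: e1 + ip g a2 u *: e2).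
Context (hue2 : forall u, P u ->
  bracket u e2 = ip g b1 u *: e1 + ip g b2 u *: e2).
Context (huv : forall u v, P u -> P v ->
  bracket u v = ip g (f1 u) v *: e1 + ip g (f2 u) v *: e2).

(** For the converse, under the three conditions the operator ad X kills P and
    acts on the plane of e1 and e2 as a multiple g(a2, X) of the rotation by a
    right angle, so it is skew. *)
Lemma killing_iff X : P X ->
  (forall Y Z, left_invariant Y -> left_invariant Z ->
     ip g (bracket X Y) Z + ip g (bracket X Z) Y = 0) <->
  (ker_on P f1 `&` ker_on P f2 `&`
      orth_compl g (lin_span [set a1; b2; a2 + b1])) X.
Proof.
move=> PX; have [lX XD] := PX; have [_ hX] := lX.
have l1 := derived_left_invariant frame1_derived.
have l2 := derived_left_invariant frame2_derived.
have ortho u : P u -> ip g e1 u = 0 /\ ip g e2 u = 0.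
  move=> [_ uD]; split; rewrite ip_sym; apply: uD.
    exact: frame1_derived.
  exact: frame2_derived.
have he21 : ip g e2 e1 = 0 by rewrite ip_sym.
split=> [K|[[[_ f1X] [_ f2X]] [_ XS]] Y Z hY hZ].
  have fX0 f e : (forall u, P u -> P (f u)) -> left_invariant e ->
      (forall u, P u -> ip g e u = 0 /\ ip g (bracket X u) e = ip g (f X) u /\
         ip g (bracket X e) u = 0) -> f X = 0.
    (* f X is orthogonal to all u in P, in particular to itself. *)
    move=> hf le H; have [[_ lf] _] := hf X PX; apply: ip_eq0 => //.
    have [_ [<- h]] := H _ (hf X PX).
    exact: (etrans (esym (addr0 _)) (etrans (congr1 _ (esym h)) (K (f X) e lf le))).
  split; first split; split=> //.
  - apply: (fX0 f1 e1) => // u Pu; have [p1 p2] := ortho u Pu; split=> //.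
    by rewrite huv// hue1// !ipDl !ipZl he11 he21 p1 p2; split; ring.
  - apply: (fX0 f2 e2) => // u Pu; have [p1 p2] := ortho u Pu; split=> //.
    by rewrite huv// hue2// !ipDl !ipZl he22 he12 p1 p2; split; ring.
  - move=> W; apply: lin_span_orth => {W} _ [[->|->]|->]; rewrite ip_sym.
    + have := K e1 e1 l1 l1.
      by rewrite hue1// !ipDl !ipZl he11 he21; lra.
    + have := K e2 e2 l2 l2.
      by rewrite hue2// !ipDl !ipZl he22 he12; lra.
    + have := K e1 e2 l1 l2.
      by rewrite hue1// hue2// !ipDl !ipZl he11 he22 he12 he21; lra.
have S s : [set a1; b2; a2 + b1] s -> ip g s X = 0.
  by move=> Ss; rewrite ip_sym; apply: XS; exact: lin_span_mem.
have a1X : ip g a1 X = 0 by apply: S; left; left.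
have b2X : ip g b2 X = 0 by apply: S; left; right.
have abX : ip g a2 X + ip g b1 X = 0 by rewrite -ipDl; apply: S; right.
have XY W : left_invariant W -> bracket X W
    = ip g a2 X *: (ip g W e1 *: e2 - ip g W e2 *: e1).
  move=> hW; have [u Pu eW] := orth_decomposition hW.
  have [[_ lu] _] := Pu.
  have Xu : bracket X u = 0 by rewrite huv// f1X f2X !ip0l !scale0r addr0.
  rewrite {1}eW !bracket_lin//; last by apply: left_invariant_lin.
  rewrite Xu hue1// hue2// a1X b2X !scale0r add0r !addr0.
  have -> : ip g b1 X = - ip g a2 X by lra.
  by rewrite scalerBr !scalerA mulrN scaleNr ![ip g a2 X * _]mulrC.
rewrite (XY Y hY) (XY Z hZ) !(ipZl, ipDl) -!scaleNr !ipZl.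
rewrite ![ip g e1 _]ip_sym ![ip g e2 _]ip_sym; ring.
Qed.

End Frame.
End LieAlgebra.

Theorem theorem3p5 (R : realType) (n : nat) (G : TopGroup.type)
    (A : smooth_atlas R n G) (hG : lie_group A) (hconn : connected [set: G])
    (g : tensor2 A) (hg : riemannian_metric g)
    (hginv : left_invariant_metric g)
    (e1 e2 : vfield A)
    (he : derived_algebra A = lin_span [set e1; e2])
    (he11 : ip g e1 e1 = 1) (he22 : ip g e2 e2 = 1) (he12 : ip g e1 e2 = 0)
    (P : set (vfield A)) (hP : P = orth_compl g (derived_algebra A))
    (a1 a2 b1 b2 : vfield A) (ha1 : P a1) (ha2 : P a2) (hb1 : P b1) (hb2 : P b2)
    (f1 f2 : vfield A -> vfield A)
    (hf1 : linear_endo_on P f1) (hf2 : linear_endo_on P f2)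
    (hf1s : skew_on g P f1) (hf2s : skew_on g P f2)
    (hue1 : forall u, P u ->
       bracket u e1 = ip g a1 u *: e1 + ip g a2 u *: e2)
    (hue2 : forall u, P u ->
       bracket u e2 = ip g b1 u *: e1 + ip g b2 u *: e2)
    (huv : forall u v, P u -> P v ->
       bracket u v = ip g (f1 u) v *: e1 + ip g (f2 u) v *: e2)
    (X : vfield A) (hX : lie_algebra X) (hX0 : X <> 0)
    (hX1 : forall p : G, Num.sqrt (metric_at g p (X p) (X p)) < 1) :
  (randers_douglas g X <-> P X) /\
  (berwald A (randers g X) <->
     (ker_on P f1 `&` ker_on P f2 `&`
      orth_compl g (lin_span [set a1; b2; a2 + b1])) X).
Proof.
(* A unit vector such as the value of e1 at 1 does not exist in dimension 0. *)
subst P; have n_gt0 : (0 < n)%N.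
  rewrite lt0n; apply/eqP => n0; move/eqP: he11.
  rewrite /ip /metric_at mxE big1 ?[_ == 1]eq_sym ?oner_eq0// => k _.
  by have := ltn_ord k; rewrite {2}n0.
have [_ lX] := hX.
have douglas := douglas_iff hG g hX.
split; first by rewrite /randers_douglas (closed_form_bracket hG hg hginv lX).
rewrite (berwald_randers_iff hG hg hginv lX hX1 n_gt0) douglas.
have killing := killing_iff hG hg he he11 he22 he12 hf1.1 hf2.1 hue1 hue2 huv.
split=> [[PX K]|K]; first exact/killing.
by have PX := K.1.1.1; split=> //; apply/killing.
Qed.
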